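(* Let $\Gamma \subseteq \mathbb{R}^d$ be an acute, convex, solid cone with dual cone $\Gamma^\ast = \{ \eta \in \mathbb{R}^d: \eta \cdot x \geq 0 \text{ for all } x \in \Gamma \}$, and let $\mu$ be an admissible measure supported by $\Gamma^\ast$. There exists an admissible measure supported on $\Gamma^\ast$, different from $\mu$ and moment equivalent to $\mu$, if and only if there exists $a \in \operatorname{int}\Gamma$ such that $$ \sup_{p(x) \leq \frac{1}{a\cdot x+1}\ \forall x \in \Gamma^\ast} \int p \, d\mu \;<\; \inf_{q(x) \geq \frac{1}{a\cdot x+1}\ \forall x \in \Gamma^\ast} \int q\, d\mu ,$$ where $p,q$ range over real polynomials. Moreover, when this holds, the set of $a\in\operatorname{int}\Gamma$ for which the strict inequality holds is an open, everywhere dense subset of $\operatorname{int}\Gamma$.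
   Context: An admissible measure on a closed set $X \subseteq \mathbb{R}^d$ is a positive Radon measure $\mu$ supported on $X$ such that $\int_X |p|\,d\mu<\infty$ for every polynomial $p$. Two admissible measures are moment equivalent if they give the same integral to every polynomial. A cone is acute if its closure contains no line, and solid if it has nonempty interior. *)

(* Defs.v *)
From HB Require Import structures.
From mathcomp Require Import all_boot all_order all_algebra.
From mathcomp Require Import all_classical all_reals all_analysis.
From mathcomp Require mpoly.
Set Implicit Arguments. Unset Strict Implicit. Unset Printing Implicit Defensive.
Import Order.TTheory GRing.Theory Num.Theory.
Import numFieldNormedType.Exports.
Local Open Scope classical_set_scope.
Local Open Scope ring_scope.

Definition Rd (R : realType) (d : nat) := g_sigma_algebraType (@open 'rV[R]_d).

Definition dotp (R : realType) (d : nat) (a x : 'rV[R]_d) : R :=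
  \sum_(i < d) a ord0 i * x ord0 i.

Definition polyfun (R : realType) (d : nat) (p : mpoly.mpoly d R) (x : 'rV[R]_d) : R :=
  mpoly.meval (fun i => x ord0 i) p.

Definition is_cone (R : realType) (d : nat) (G : set 'rV[R]_d) : Prop :=
  forall x (t : R), G x -> 0 < t -> G (t *: x).

Definition convex_subset (R : realType) (d : nat) (G : set 'rV[R]_d) : Prop :=
  forall x y (t : R), G x -> G y -> 0 <= t -> t <= 1 -> G (t *: x + (1 - t) *: y).

Definition acute (R : realType) (d : nat) (G : set 'rV[R]_d) : Prop :=
  ~ (exists x v : 'rV[R]_d, v != 0 /\ forall t : R, closure G (x + t *: v)).

Definition solid (R : realType) (d : nat) (G : set 'rV[R]_d) : Prop :=
  interior G !=set0.

Definition dual_cone (R : realType) (d : nat) (G : set 'rV[R]_d) : set 'rV[R]_d :=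
  [set eta | forall x, G x -> 0 <= dotp eta x].

Definition radon (R : realType) (d : nat) (mu : {measure set (Rd R d) -> \bar R}) : Prop :=
  forall K : set 'rV[R]_d, compact K -> (mu K < +oo)%E.

Definition supported_on (R : realType) (d : nat) (mu : {measure set (Rd R d) -> \bar R})
  (X : set 'rV[R]_d) : Prop := mu (~` X) = 0%E.

Definition admissible (R : realType) (d : nat) (mu : {measure set (Rd R d) -> \bar R})
  (X : set 'rV[R]_d) : Prop :=
  [/\ radon mu, supported_on mu X &
      forall p : mpoly.mpoly d R, mu.-integrable setT (fun x : Rd R d => (polyfun p x)%:E)].

Definition moment_equiv (R : realType) (d : nat) (mu nu : {measure set (Rd R d) -> \bar R}) : Prop :=
  forall p : mpoly.mpoly d R,
    (\int[mu]_x (polyfun p x)%:E = \int[nu]_x (polyfun p x)%:E)%E.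

Definition lower_val (R : realType) (d : nat) (mu : {measure set (Rd R d) -> \bar R})
  (X : set 'rV[R]_d) (a : 'rV[R]_d) : \bar R :=
  ereal_sup [set (\int[mu]_x (polyfun p x)%:E)%E | p in
    [set p : mpoly.mpoly d R | forall x, X x -> polyfun p x <= (dotp a x + 1)^-1]].

Definition upper_val (R : realType) (d : nat) (mu : {measure set (Rd R d) -> \bar R})
  (X : set 'rV[R]_d) (a : 'rV[R]_d) : \bar R :=
  ereal_inf [set (\int[mu]_x (polyfun q x)%:E)%E | q in
    [set q : mpoly.mpoly d R | forall x, X x -> (dotp a x + 1)^-1 <= polyfun q x]].

(* Main.v *)
(* Let K be the dual cone and F_m(a) the integral of 1 / (1 + a.x) with respect to m. For
   every measure m moment equivalent to mu, F_m(a) lies between the two extremal values.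

   A gap at a yields a second measure. The functional P(f) = inf {int q dmu | q >= f on K},
   on functions dominated on K by a polynomial, is sublinear; Hahn-Banach gives a linear
   functional below P that takes the value P(v) at v = 1 / (1 + a.x) or at its opposite. It
   is positive, it extends int . dmu from the polynomials, and it is represented by a measure
   because the second moments make it tight.

   Conversely, if there is no gap on a nonempty open subset of int(Gamma), then F_mu = F_nu
   there, and this forces mu = nu. Put w = 1 / (1 + b.x) and z_c = (c.x) w, which is bounded
   on K. Expanding t |-> F(b + tc) at t = 0 identifies the integrals of z_c^n w, hence those
   of exp(z_c) w. Products of such exponentials are again of this form, so bounded limits
   give the indicators of the half-spaces {z_c < s}; with c = e_i + s b this is {x_i < s}.
   Since w = 1 - z_b, the weight is removed by a geometric series. This gives both the
   existence of a gap and the density of the gaps; openness holds because F_mu and F_nu are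
   continuous. *)

Require Import Defs.
From HB Require Import structures.
From mathcomp Require Import all_boot all_order all_algebra.
From mathcomp Require Import all_classical all_reals all_analysis.
From mathcomp Require Import measurable_realfun ring lra.
From mathcomp Require mpoly.
Import (coercions,canonicals) mpoly.
Set Implicit Arguments. Unset Strict Implicit. Unset Printing Implicit Defensive.
Import Order.TTheory GRing.Theory Num.Theory.
Import numFieldNormedType.Exports.
Local Open Scope classical_set_scope.
Local Open Scope ring_scope.

(** * Hahn-Banach *)

Section HahnBanach.
Context {R : realType} {E : lmodType R}.
Implicit Types (u v x y : E).

Definition sublinear (p : E -> R) :=
  (forall x y, p (x + y) <= p x + p y) /\
  (forall (t : R) x, 0 < t -> p (t *: x) = t * p x).

Lemma sublinear0 p : sublinear p -> p 0 = 0.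
Proof.
by move=> [_ pZ]; have := pZ 2 0 (ltr0Sn _ _); rewrite scaler0 => h; lra.
Qed.

Lemma sublinearN p x : sublinear p -> - p (- x) <= p x.
Proof.
move=> sp; have := sp.1 x (- x); rewrite subrr sublinear0// => h; lra.
Qed.

(** Zorn's lemma applies because the pointwise infimum of a chain is again sublinear; the bound
    [- p (- x)], common to all sublinear functionals below [p], keeps it finite. *)
Lemma sublinear_minimal p : sublinear p ->
  exists q, [/\ sublinear q, forall x, q x <= p x &
    forall r, sublinear r -> (forall x, r x <= q x) -> r = q].
Proof.
move=> sp.
pose dom (q : E -> R) := sublinear q /\ forall x, q x <= p x.
pose T := {q : E -> R | dom q}.
(* The order is reversed, so that a maximal element for Zorn is a minimal functional. *)
pose below (q r : T) := `[< forall x, sval r x <= sval q x >].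
have [||||[q [sq qp]] qmin] := @Zorn T below.
- by move=> q; apply/asboolP.
- move=> q r s /asboolP rq /asboolP sr; apply/asboolP => x.
  exact: le_trans (sr x) (rq x).
- move=> [q hq] [r hr] /asboolP rq /asboolP qr; apply: eq_exist => /=.
  by apply/funext => x; apply/eqP; rewrite eq_le rq qr.
(* The empty chain is bounded by [p] itself. *)
- move=> A totA; have [[q0 Aq0]|A0] := pselect (exists q, A q); last first.
    exists (exist dom p (conj sp (fun=> lexx _))) => q Aq.
    by exfalso; apply: A0; exists q.
  pose S x := [set sval q x | q in A].
  have S0 x : S x !=set0 by exists (sval q0 x), q0.
  have lbS x : lbound (S x) (- p (- x)).
    move=> _ [q Aq <-]; have [sq qp] := svalP q.
    by apply: le_trans _ (sublinearN x sq); rewrite lerN2.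
  have hS x : has_inf (S x) by split => //; exists (- p (- x)).
  have Sle q x : A q -> inf (S x) <= sval q x.
    by move=> Aq; apply: ge_inf; [have [] := hS x|exists q].
  have ip x : inf (S x) <= p x by apply: le_trans (Sle _ _ Aq0) _; have [_] := svalP q0.
  have si : sublinear (fun x => inf (S x)).
    split=> [x y|t x t0].
      rewrite -lerBlDr; apply: lb_le_inf => // _ [q Aq <-].
      rewrite lerBlDr -lerBlDl; apply: lb_le_inf => // _ [r Ar <-]; rewrite lerBlDl.
      (* Subadditivity of the infimum needs one member of the chain below both [q] and [r]; totality
         supplies it. *)
      have [/asboolP rq|/asboolP qr] := totA q r Aq Ar.
        apply: le_trans (Sle r _ Ar) _; have [[rD _] _] := svalP r.
        by apply: le_trans (rD _ _) _; rewrite lerD2r.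
      apply: le_trans (Sle q _ Aq) _; have [[qD _] _] := svalP q.
      by apply: le_trans (qD _ _) _; rewrite lerD2l.
    apply/eqP; rewrite eq_le; apply/andP; split.
      rewrite -ler_pdivrMl//; apply: lb_le_inf => // _ [q Aq <-].
      have [[_ qZ] _] := svalP q.
      by rewrite ler_pdivrMl// -qZ//; exact: Sle.
    apply: lb_le_inf => // _ [q Aq <-]; have [[_ qZ] _] := svalP q.
    by rewrite qZ// ler_pM2l//; exact: Sle.
  exists (exist dom _ (conj si ip)) => q Aq; apply/asboolP => x /=; exact: Sle.
- exists q; split => // r sr rq.
  have rp x : r x <= p x by apply: le_trans (qp x).
  by have /(congr1 sval) := qmin (exist dom r (conj sr rp)) (asboolT rq).
Qed.

(* [r x] is the infimum over [t >= 0] of [q (x + t v) - t q v]. A minimal sublinear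
   functional cannot descend in any direction, so it is odd, hence linear. *)
Lemma sublinear_descent (q : E -> R) v : sublinear q ->
  exists r, [/\ sublinear r, forall x, r x <= q x & r (- v) <= - q v].
Proof.
move=> sq; pose S x := [set q (x + t *: v) - t * q v | t in [set t : R | 0 <= t]].
have qZ0 t x : 0 <= t -> q (t *: x) = t * q x.
  rewrite le_eqVlt => /predU1P[<-|t0]; last exact: sq.2.
  by rewrite scale0r mul0r sublinear0.
have S0 x : S x !=set0 by exists (q (x + 0 *: v) - 0 * q v); exists 0 => /=.
have lbS x : lbound (S x) (- q (- x)).
  move=> _ [t /= t0 <-]; rewrite -qZ0// lerBrDr.
  have := sq.1 (x + t *: v) (- x); rewrite addrAC subrr add0r; lra.
have hS x : has_inf (S x) by split => //; exists (- q (- x)).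
have Sle t x : 0 <= t -> inf (S x) <= q (x + t *: v) - t * q v.
  by move=> t0; apply: ge_inf; [have [] := hS x|exists t].
exists (fun x => inf (S x)); split.
- split=> [x y|t x t0].
    rewrite -lerBlDr; apply: lb_le_inf => // _ [t /= t0 <-].
    rewrite lerBlDr -lerBlDl; apply: lb_le_inf => // _ [s /= s0 <-]; rewrite lerBlDl.
    apply: le_trans (Sle (t + s) _ (addr_ge0 t0 s0)) _.
    by have := sq.1 (x + t *: v) (y + s *: v); rewrite addrACA -scalerDl; lra.
  apply/eqP; rewrite eq_le; apply/andP; split.
    rewrite -ler_pdivrMl//; apply: lb_le_inf => // _ [s /= s0 <-].
    rewrite ler_pdivrMl// mulrBr -(sq.2 t (_ + _))// scalerDr scalerA mulrA.
    by apply: Sle; rewrite mulr_ge0// ltW.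
  apply: lb_le_inf => // _ [s /= s0 <-].
  rewrite -ler_pdivlMl//; apply: le_trans (Sle (t^-1 * s) _ _) _.
    by rewrite mulr_ge0// invr_ge0 ltW.
  rewrite ler_pdivlMl// mulrBr -(sq.2 t (_ + _))// scalerDr scalerA !mulrA.
  by rewrite divff ?mul1r ?gt_eqF.
- by move=> x; apply: le_trans (Sle 0 _ (lexx _)) _; rewrite scale0r addr0 mul0r subr0.
- apply: le_trans (Sle 1 _ ler01) _.
  by rewrite scale1r addNr sublinear0// mul1r sub0r.
Qed.

(** Descending along [v] before minimizing gives [f (- v) <= - p v]. By minimality, descent along
    any [x] leaves [f] unchanged, so [f] is odd; an odd sublinear functional is linear, and oddness
    at [v] yields [f v = p v]. *)
Theorem hahn_banach (p : E -> R) v : sublinear p ->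
  exists f : E -> R, [/\ forall x y, f (x + y) = f x + f y,
    forall (t : R) x, f (t *: x) = t * f x,
    forall x, f x <= p x & f v = p v].
Proof.
move=> sp; have [r [sr rp rv]] := sublinear_descent v sp.
have [f [sf fr fmin]] := sublinear_minimal sr.
have fN x : f (- x) = - f x.
  have [g [sg gf gx]] := sublinear_descent x sf.
  have -> : f (- x) = g (- x) by rewrite (fmin g sg gf).
  apply/eqP; rewrite eq_le gx/=.
  by rewrite -[leRHS]opprK lerN2; apply: le_trans (sublinearN _ sg) (gf _).
exists f; split.
- move=> x y; apply/eqP; rewrite eq_le sf.1/=.
  by rewrite -lerN2 -fN opprD (le_trans (sf.1 _ _))// !fN opprD.
- move=> t x; have [t0|t0|->] := ltgtP t 0; last by rewrite scale0r sublinear0// mul0r.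
    by rewrite -{1}[t]opprK scaleNr fN sf.2 ?oppr_gt0// mulNr opprK.
  exact: sf.2.
- by move=> x; apply: le_trans (rp x).
- apply/eqP; rewrite eq_le (le_trans (fr v))//= -lerN2 -fN.
  by apply: le_trans rv; exact: fr.
Qed.

End HahnBanach.

(** * Borel sets and continuous functions *)

Section Borel.
Context {R : realType} {d : nat}.
Local Notation T := 'rV[R]_d.

Definition halfspaces : set (set T) :=
  [set A | exists i s, A = [set x : T | x ord0 i < s]].

(** An open set is the countable union of the boxes it contains that have a rational centre and a
    radius [1 / (k + 1)]; each box is a finite intersection of slabs, obtained from half-spaces. *)
Lemma open_sigma_halfspaces (U : set T) : open U -> <<s halfspaces >> U.
Proof.
move=> oU; pose HT := g_sigma_algebraType halfspaces.
have mlt i s : measurable ([set x : T | x ord0 i < s] : set HT).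
  by apply: sub_sigma_algebra; exists i, s.
have mle i s : measurable ([set x : T | x ord0 i <= s] : set HT).
  have -> : [set x : T | x ord0 i <= s] =
      ~` (\bigcup_n ~` [set x : T | x ord0 i < s + n.+1%:R^-1]).
    apply/seteqP; split => x /=.
      move=> xs [n _]; apply.
      by rewrite /= (le_lt_trans xs)// ltrDl invr_gt0.
    move=> h; rewrite leNgt; apply/negP => sx; apply: h.
    have [n hn] : exists n, n.+1%:R^-1 < x ord0 i - s.
      have sx' : 0 < x ord0 i - s by rewrite subr_gt0.
      exists (Num.bound (x ord0 i - s)^-1); rewrite invf_plt ?posrE//.
      apply: lt_le_trans (archi_boundP _) _; first by rewrite invr_ge0 ltW.
      by rewrite ler_nat.
    by exists n => //=; move: hn; rewrite ltrBrDl => /ltW hn /lt_geF; rewrite hn.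
  apply: measurableC; apply: bigcupT_measurable => n.
  by apply: measurableC; exact: mlt.
pose box (p : 'rV[rat]_d * nat) : set T :=
  ~` \bigcup_i ~` [set x : T | `|x ord0 i - ratr (p.1 ord0 i)| < p.2.+1%:R^-1].
have mbox p : measurable (box p : set HT).
  apply: measurableC; apply: countable_bigcupT_measurable => // i.
  apply: measurableC.
  move: (ratr _) (p.2.+1%:R^-1) => c e.
  have -> : [set x : T | `|x ord0 i - c| < e] =
      [set x : T | x ord0 i < c + e] `\` [set x : T | x ord0 i <= c - e].
    apply/seteqP; split => x /=; rewrite ltr_norml.
      by move=> /andP[? ?]; split; [|apply/negP; rewrite -ltNge]; lra.
    by move=> [? /negP]; rewrite -ltNge => ?; apply/andP; split; lra.
  exact: measurableD.
suff -> : U = \bigcup_(p : 'rV[rat]_d * nat)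
    (if `[< box p `<=` U >] then box p else set0).
  apply: (@countable_bigcupT_measurable _ HT) => // p.
  by case: ifP => // _; exact: mbox.
apply/seteqP; split => x; last first.
  by move=> [p _]; case: ifPn => // /asboolP; apply.
move=> Ux; have /nbhs_ballP[e /= e0 eU] := open_nbhs_nbhs (conj oU Ux).
(* A box of radius [1 / (k + 1)] that contains [x] lies within [2 / (k + 1) < e] of [x]. *)
pose k := Num.bound (2 * e^-1).
have ke : 2 * k.+1%:R^-1 < e.
  rewrite ltr_pdivrMr// mulrC -ltr_pdivrMr// -/(_^-1).
  apply: lt_le_trans (archi_boundP _) _; first by rewrite mulr_ge0// invr_ge0 ltW.
  by rewrite ler_nat.
have k0 : 0 < k.+1%:R^-1 :> R by rewrite invr_gt0.
have [c hc] : exists c : 'rV[rat]_d, forall i, `|x ord0 i - ratr (c ord0 i)| < k.+1%:R^-1.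
  have hq i : exists q : rat, `|x ord0 i - ratr q| < k.+1%:R^-1.
    move: (k.+1%:R^-1) k0 => r r0.
    have [|q] := @rat_in_itvoo R (x ord0 i) (x ord0 i + r); first by lra.
    by rewrite in_itv/= => /andP[? ?]; exists q; rewrite ltr_norml; apply/andP; split; lra.
  by exists (\row_i sval (cid (hq i))) => i; rewrite mxE; case: cid.
exists (c, k) => //; case: ifPn => [_|/asboolPn].
  by move=> [i _]; apply; exact: hc.
case=> y; rewrite /box/= => hy; apply: eU; split => // i j.
have hyj : `|y ord0 j - ratr (c ord0 j)| < k.+1%:R^-1.
  by apply: contrapT => n; apply: hy; exists j.
rewrite (ord1 i) /ball/=.
have -> : x ord0 j - y ord0 j =
  (x ord0 j - ratr (c ord0 j)) - (y ord0 j - ratr (c ord0 j)) by ring.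
apply: le_lt_trans (ler_normB _ _) _; have := hc j.
by move: (k.+1%:R^-1) ke hyj => r *; lra.
Qed.

Lemma continuous_measurable_Rd (D : set (Rd R d)) (f : T -> R) : measurable D ->
  continuous f -> measurable_fun D (f : Rd R d -> R).
Proof.
move=> mD /continuousP cf; apply: measurable_funTS.
apply: (measurability _ (measurable_realfun.RGenOpens.measurableE R)).
move=> _ [_ [a [b ->] <-]]; rewrite setTI.
by apply: sub_sigma_algebra; apply: cf; exact: interval_open.
Qed.

End Borel.

(** * Pointwise operations on continuous real functions *)

Section Continuity.
Context {R : realType} {T : topologicalType}.
Implicit Types f g : T -> R.

Lemma continuous_addf f g : continuous f -> continuous g ->
  continuous (fun x => f x + g x).
Proof. by move=> cf cg x; exact: (cvgD (cf x) (cg x)). Qed.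

Lemma continuous_mulf f g : continuous f -> continuous g ->
  continuous (fun x => f x * g x).
Proof. by move=> cf cg x; exact: (cvgM (cf x) (cg x)). Qed.

Lemma continuous_cstf (c : R) : continuous (fun _ : T => c).
Proof. by move=> x; exact: cvg_cst. Qed.

Lemma continuous_oppf f : continuous f -> continuous (fun x => - f x).
Proof. by move=> cf x; exact: (cvgN (cf x)). Qed.

Lemma continuous_subf f g : continuous f -> continuous g ->
  continuous (fun x => f x - g x).
Proof. by move=> cf cg; apply: continuous_addf => //; exact: continuous_oppf. Qed.

Lemma continuous_normf f : continuous f -> continuous (fun x => `|f x|).
Proof. by move=> cf x; exact: (cvg_norm (cf x)). Qed.

Lemma continuous_maxf f g : continuous f -> continuous g ->
  continuous (fun x => Num.max (f x) (g x)).
Proof.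
move=> cf cg; under eq_fun do rewrite maxr_absE.
apply: continuous_mulf; last exact: continuous_cstf.
by apply: continuous_addf; [exact: continuous_addf|
  apply: continuous_normf; exact: continuous_subf].
Qed.

Lemma continuous_minf f g : continuous f -> continuous g ->
  continuous (fun x => Num.min (f x) (g x)).
Proof.
move=> cf cg; under eq_fun do rewrite minr_absE.
apply: continuous_mulf; last exact: continuous_cstf.
by apply: continuous_subf; [exact: continuous_addf|
  apply: continuous_normf; exact: continuous_subf].
Qed.

Lemma continuous_invf f : (forall x, f x != 0) -> continuous f ->
  continuous (fun x => (f x)^-1).
Proof. by move=> f0 cf x; exact: (cvgV (f0 x) (cf x)). Qed.

Lemma continuous_sumf (I : Type) (r : seq I) (F : I -> T -> R) :
  (forall i, continuous (F i)) -> continuous (fun x => \sum_(i <- r) F i x).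
Proof.
move=> cF; elim: r => [|i r ih].
  by under eq_fun do rewrite big_nil; exact: continuous_cstf.
by under eq_fun do rewrite big_cons; exact: continuous_addf.
Qed.

Lemma continuous_prodf (I : Type) (r : seq I) (F : I -> T -> R) :
  (forall i, continuous (F i)) -> continuous (fun x => \prod_(i <- r) F i x).
Proof.
move=> cF; elim: r => [|i r ih].
  by under eq_fun do rewrite big_nil; exact: continuous_cstf.
by under eq_fun do rewrite big_cons; exact: continuous_mulf.
Qed.

Lemma continuous_expf f n : continuous f -> continuous (fun x => f x ^+ n).
Proof.
move=> cf; elim: n => [|n ih].
  by under eq_fun do rewrite expr0; exact: continuous_cstf.
by under eq_fun do rewrite exprS; exact: continuous_mulf.
Qed.

End Continuity.

(** * Polynomial functions and domination by polynomials *)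

Section Polyfun.
Context {R : realType} {d : nat}.
Implicit Types (p q : mpoly.mpoly d R) (x : 'rV[R]_d).

Lemma polyfunD p q x : polyfun (p + q) x = polyfun p x + polyfun q x.
Proof. exact: mpoly.mevalD. Qed.

Lemma polyfunN p x : polyfun (- p) x = - polyfun p x.
Proof. exact: mpoly.mevalN. Qed.

Lemma polyfunZ c p x : polyfun (c *: p) x = c * polyfun p x.
Proof. exact: mpoly.mevalZ. Qed.

Lemma polyfunM p q x : polyfun (p * q) x = polyfun p x * polyfun q x.
Proof. exact: mpoly.mevalM. Qed.

Lemma polyfunC c x : polyfun (mpoly.mpolyC d c) x = c.
Proof. exact: mpoly.mevalC. Qed.

Lemma polyfun_coord i x : polyfun (mpoly.mpolyX R (mpoly.mnm1 i)) x = x ord0 i.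
Proof. exact: mpoly.mevalXU. Qed.

Lemma continuous_polyfun p : continuous (polyfun p).
Proof.
have -> : polyfun p = fun x => \sum_(m <- mpoly.msupp p)
    mpoly.mcoeff m p * \prod_i x ord0 i ^+ m i.
  by apply/funext => x; rewrite /polyfun mpoly.mevalE.
apply: continuous_sumf => m; apply: continuous_mulf; first exact: continuous_cstf.
apply: continuous_prodf => i; apply: continuous_expf; exact: coord_continuous.
Qed.

(** This is the space on which the moment functional is extended. It contains the squares of its
    members, which later controls tails. *)
Definition polybounded (K : set 'rV[R]_d) (f : 'rV[R]_d -> R) :=
  exists q : mpoly.mpoly d R, forall x, K x -> `|f x| <= polyfun q x.

End Polyfun.

Section Polybounded.
Context {R : realType} {d : nat} {K : set 'rV[R]_d}.
Implicit Types f g : 'rV[R]_d -> R.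

Lemma polybounded_cst c : polybounded K (fun=> c).
Proof. by exists (mpoly.mpolyC d `|c|) => x _; rewrite polyfunC. Qed.

Lemma polyboundedD f g : polybounded K f -> polybounded K g ->
  polybounded K (fun x => f x + g x).
Proof.
move=> [p fp] [q gq]; exists (p + q) => x Kx; rewrite polyfunD.
by apply: le_trans (ler_normD _ _) _; rewrite lerD ?fp ?gq.
Qed.

Lemma polyboundedM f g : polybounded K f -> polybounded K g ->
  polybounded K (fun x => f x * g x).
Proof.
move=> [p fp] [q gq]; exists (p * q) => x Kx.
by rewrite polyfunM normrM ler_pM ?fp ?gq.
Qed.

Lemma le_polybounded f g : (forall x, K x -> `|f x| <= `|g x|) ->
  polybounded K g -> polybounded K f.
Proof. by move=> fg [q gq]; exists q => x Kx; apply: le_trans (gq _ Kx); exact: fg. Qed.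

Lemma polyboundedZ c f : polybounded K f -> polybounded K (fun x => c * f x).
Proof. exact/polyboundedM/polybounded_cst. Qed.

Lemma polyboundedN f : polybounded K f -> polybounded K (fun x => - f x).
Proof. by apply: le_polybounded => x _; rewrite normrN. Qed.

Lemma polyboundedB f g : polybounded K f -> polybounded K g ->
  polybounded K (fun x => f x - g x).
Proof. by move=> Vf Vg; apply: polyboundedD => //; exact: polyboundedN. Qed.

Lemma polybounded_sum (I : Type) (r : seq I) (F : I -> 'rV[R]_d -> R) :
  (forall i, polybounded K (F i)) -> polybounded K (fun x => \sum_(i <- r) F i x).
Proof.
move=> cF; elim: r => [|i r ih].
  by under eq_fun do rewrite big_nil; exact: polybounded_cst.
by under eq_fun do rewrite big_cons; exact: polyboundedD.
Qed.

Lemma polybounded_polyfun p : polybounded K (polyfun p).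
Proof.
(* A polynomial may change sign, so the dominating one is [p^2 + 1], by [|y| <= y^2 + 1]. *)
exists (p * p + mpoly.mpolyC d 1) => x _; rewrite polyfunD polyfunM polyfunC.
by move: (polyfun p x) => y; rewrite ler_norml; apply/andP; split; nra.
Qed.

End Polybounded.

(** * Riesz representation of tight positive functionals *)

Section Riesz.
Context {R : realType} {d : nat}.
Local Notation T := 'rV[R]_d.
Variables (K : set T) (lam : (T -> R) -> R).
Local Notation V := (polybounded K).
Hypothesis Kcl : closed K.
Hypothesis lamD : forall f g, V f -> V g ->
  lam (fun x => f x + g x) = lam f + lam g.
Hypothesis lamZ : forall c f, V f -> lam (fun x => c * f x) = c * lam f.
Hypothesis lam_ge0 : forall f, V f -> (forall x, K x -> 0 <= f x) -> 0 <= lam f.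

Lemma lamB f g : V f -> V g -> lam (fun x => f x - g x) = lam f - lam g.
Proof.
move=> Vf Vg; have -> : (fun x => f x - g x) = (fun x => f x + (-1) * g x).
  by apply/funext => x; rewrite mulN1r.
by rewrite lamD ?lamZ ?mulN1r//; exact: polyboundedZ.
Qed.

Lemma le_lam f g : V f -> V g -> (forall x, K x -> f x <= g x) -> lam f <= lam g.
Proof.
move=> Vf Vg fg; rewrite -subr_ge0 -lamB//; apply: lam_ge0; first exact: polyboundedB.
by move=> x Kx; rewrite subr_ge0; exact: fg.
Qed.

Lemma lam0 : lam (fun=> 0) = 0.
Proof.
rewrite -[RHS](mul0r (lam (fun=> 0))) -lamZ; last exact: polybounded_cst.
by congr lam; apply/funext => x; rewrite mul0r.
Qed.

Lemma lam_sum (F : nat -> T -> R) n : (forall i, V (F i)) ->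
  lam (fun x => \sum_(i < n) F i x) = \sum_(i < n) lam (F i).
Proof.
move=> VF; elim: n => [|n ih].
  by rewrite big_ord0; under eq_fun do rewrite big_ord0; exact: lam0.
under eq_fun do rewrite big_ord_recr/=.
by rewrite lamD ?ih ?big_ord_recr//; exact: polybounded_sum.
Qed.

(* Covers are monotone sequences rather than series, so that countable subadditivity of
   the outer measure requires no double series. *)
Definition cover_fun (A : set T) (g : nat -> T -> R) :=
  [/\ forall n, continuous (g n), forall n, V (g n), forall n x, 0 <= g n x,
      forall n x, g n x <= g n.+1 x &
      forall x, K x -> A x -> exists n, 1 <= g n x].

Definition cover_cost (A : set T) : set R :=
  [set c | exists2 g, cover_fun A g & forall n, lam (g n) <= c].

(** Real values suffice: the constant cover [1] makes every set of costs nonempty, and costs are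
    nonnegative. *)
Definition outer (A : set T) : R := inf (cover_cost A).

Lemma cover_fun_le A g : cover_fun A g ->
  forall n m x, (n <= m)%N -> g n x <= g m x.
Proof.
move=> [_ _ _ gS _] n m x nm.
by have /nondecreasing_seqP := (fun n => gS n x); apply.
Qed.

Lemma cover_cost_ge0 A c : cover_cost A c -> 0 <= c.
Proof.
by move=> [g [_ Vg g0 _ _] gc]; apply: le_trans (gc 0); exact: lam_ge0.
Qed.

Lemma cover_cost1 A : cover_cost A (lam (fun=> 1)).
Proof.
exists (fun _ _ => 1) => //; split => // [_|_].
  exact: continuous_cstf.
exact: polybounded_cst.
Qed.

Lemma cover_cost_inf A : has_inf (cover_cost A).
Proof.
by split; [exists (lam (fun=> 1)); exact: cover_cost1|exists 0 => c /cover_cost_ge0].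
Qed.

Lemma outer_le A c : cover_cost A c -> outer A <= c.
Proof. by move=> Ac; apply: ge_inf => //; have [] := cover_cost_inf A. Qed.

Lemma cover_cost_lt A c : outer A < c -> cover_cost A c.
Proof.
move=> /(inf_lt (cover_cost_inf A).1)[e [g cg ge] ec].
by exists g => // n; apply: le_trans (ge n) (ltW ec).
Qed.

Lemma cover_cost_outer A e : 0 < e -> cover_cost A (outer A + e).
Proof. by move=> e0; apply: cover_cost_lt; rewrite ltrDl. Qed.

Lemma le_outer A c : (forall e, cover_cost A e -> c <= e) -> c <= outer A.
Proof. by move=> h; apply: lb_le_inf => //; have [] := cover_cost_inf A. Qed.

Lemma outer0 : outer set0 = 0.
Proof.
apply/eqP; rewrite eq_le; apply/andP; split; last exact/le_outer/cover_cost_ge0.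
apply: outer_le; exists (fun _ _ => 0); last first.
  by move=> _; rewrite lam0.
by split => // [_|_]; [exact: continuous_cstf|exact: polybounded_cst].
Qed.

Lemma outer_ge0 A : 0 <= outer A.
Proof. exact/le_outer/cover_cost_ge0. Qed.

Lemma outer_mono A B : A `<=` B -> outer A <= outer B.
Proof.
move=> AB; apply: le_outer => c [g [cg Vg g0 gS gB] gc]; apply: outer_le.
by exists g => //; split => // x Kx /AB; exact: gB.
Qed.

(** A diagonal cover is used: at stage [m], sum the [m]-th terms of the first [m] covers. It is
    monotone in [m], and its cost is at most a partial sum of near-optimal costs. *)
Lemma outer_bigcup (F : nat -> set T) :
  ((outer (\bigcup_n F n))%:E <= \sum_(n <oo) (outer (F n))%:E)%E.
Proof.
apply/lee_addgt0Pr => e e0.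
apply: le_trans (@epsilon_trick _ (fun n => (outer (F n))%:E) e predT
  (fun n => outer_ge0 (F n)) (ltW e0)).
set S := (\sum_(n <oo) _)%E.
have e2 n : 0 < e / (2 ^ n.+1)%:R by rewrite divr_gt0// ltr0n expn_gt0.
pose c n := outer (F n) + e / (2 ^ n.+1)%:R.
have c0 n : 0 <= c n by rewrite addr_ge0// ?outer_ge0// ltW.
have Sge n : ((\sum_(i < n) c i)%:E <= S)%E.
  rewrite -sumEFin; apply: le_trans (nneseries_lim_ge n _); last first.
    by move=> k _ _; rewrite lee_fin -/(c k).
  by rewrite big_mkord.
case: S Sge => [s Sge|Sge|/(_ 0%N)//]; last by rewrite leey.
have /choice[g hg] n : exists g, cover_fun (F n) g /\ forall m, lam (g m) <= c n.
  by have [g ? ?] := cover_cost_outer (F n) (e2 n); exists g.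
have Vg n m : V (g n m) by have [[]] := hg n.
rewrite lee_fin; apply: outer_le; exists (fun m x => \sum_(j < m) g j m x).
  split => [m|m|m x|m x|x Kx [n _ Fx]].
  - by apply: continuous_sumf => j; have [[]] := hg j.
  - exact: polybounded_sum.
  - by apply: sumr_ge0 => j _; have [[]] := hg j.
  - rewrite big_ord_recr/= -[leLHS]addr0; apply: lerD; last by have [[]] := hg m.
    by apply: ler_sum => j _; have [[_ _ _ gS _] _] := hg j.
  - have [gn _] := hg n; have [_ _ _ _ /(_ _ Kx Fx)[m gm]] := gn.
    (* From this stage on, the [n]-th cover takes part in the sum and has reached the value [1] at
       [x]. *)
    exists (m + n.+1)%N; have nm : (n < m + n.+1)%N by rewrite ltn_addl.
    rewrite (bigD1 (Ordinal nm))//= -[leLHS]addr0; apply: lerD.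
      by apply: le_trans gm _; apply: (cover_fun_le gn); rewrite leq_addr.
    by apply: sumr_ge0 => j _; have [[]] := hg j.
move=> m; rewrite (@lam_sum (fun j => g j m))//.
rewrite -lee_fin; apply: le_trans (Sge m); rewrite lee_fin.
by apply: ler_sum => j _; have [_] := hg j.
Qed.

Definition outer_measure_lam : {outer_measure set T -> \bar R} :=
  HB.pack (fun A : set T => (outer A)%:E)
    (isOuterMeasure.Build R T (fun A : set T => (outer A)%:E)
      (congr1 EFin outer0) (fun A => outer_ge0 A)
      (fun A B AB => outer_mono AB) outer_bigcup).

(* A cover [g] of [X] splits into the cover [g n * min(1, n h)] of [X `&` U] and,
   for [m] large, the cover [g n - g m * min(1, m h)] of [X `\` U]. *)
Lemma outer_caratheodory (h : T -> R) : continuous h -> (forall x, 0 <= h x) ->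
  outer_measure_lam.-caratheodory [set x | 0 < h x].
Proof.
move=> ch h0; apply: le_caratheodory_measurable => X /=.
rewrite -EFinD lee_fin; apply/ler_addgt0Pr => e e0.
have e20 : 0 < e / 2 by rewrite divr_gt0.
have [g cg gc] := cover_cost_outer X e20.
have [gcont Vg g0 gS gX] := cg.
pose k n x := Num.min 1 (n%:R * h x).
have k0 n x : 0 <= k n x by rewrite le_min ler01 mulr_ge0.
have k1 n x : k n x <= 1 by rewrite ge_min lexx.
have kS n x : k n x <= k n.+1 x.
  by rewrite /k le_min ge_min lexx/= ge_min ler_wpM2r ?orbT// ler_nat.
have ck n : continuous (k n).
  apply: continuous_minf; first exact: continuous_cstf.
  by apply: continuous_mulf => //; exact: continuous_cstf.
have gk_le n x : g n x * k n x <= g n x by rewrite ler_piMr.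
have Vgk n : V (fun x => g n x * k n x).
  apply: le_polybounded (Vg n) => x _.
  by rewrite !ger0_norm ?mulr_ge0.
pose s := sup (range (fun n => lam (fun x => g n x * k n x))).
have hs : has_sup (range (fun n => lam (fun x => g n x * k n x))).
  split; first by exists (lam (fun x => g 0%N x * k 0%N x)), 0%N.
  exists (outer X + e / 2) => _ [n _ <-]; apply: le_trans (gc n).
  by apply: le_lam => // x _.
(* The index [m] brings the cost inside the open set within [e / 2] of its supremum [s]; with the
   [e / 2] spent on [g], the total excess is at most [e]. *)
have [_ [m _ <-] sm] := sup_adherent e20 hs.
have h1 : outer (X `&` [set x | 0 < h x]) <= s.
  apply: outer_le; exists (fun n x => g n x * k n x); last first.
    by move=> n; apply: sup_upper_bound => //; exists n.
  split => [n|//|n x|n x|x Kx [/(gX _ Kx)[n gn] /= hx]].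
  - exact: continuous_mulf.
  - exact: mulr_ge0.
  - exact: ler_pM.
  - pose N := (n + Num.bound (h x)^-1)%N; exists N.
    have -> : k N x = 1.
      apply/min_idPl; rewrite -ler_pdivrMr// div1r.
      apply: (@le_trans _ _ (Num.bound (h x)^-1)%:R).
        by apply/ltW/archi_boundP; rewrite invr_ge0.
      by rewrite ler_nat leq_addl.
    by rewrite mulr1; apply: le_trans gn _; apply: (cover_fun_le cg); rewrite leq_addr.
have h2 : outer (X `&` ~` [set x | 0 < h x]) <=
    outer X + e / 2 - lam (fun x => g m x * k m x).
  (* The shift by [m] keeps the difference nonnegative, since [g m * k m <= g m <= g (n + m)]. *)
  apply: outer_le; exists (fun n x => g (n + m)%N x - g m x * k m x); last first.
    by move=> n; rewrite lamB// lerD2r.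
  split => [n|n|n x|n x|x Kx [/(gX _ Kx)[n gn] /= hx]].
  - by apply: continuous_subf => //; exact: continuous_mulf.
  - exact: polyboundedB.
  - by rewrite subr_ge0; apply: le_trans (gk_le m x) _; apply: (cover_fun_le cg); rewrite leq_addl.
  - by rewrite lerD2r addSn.
  - have hx0 : h x = 0 by apply/eqP; rewrite eq_le h0 andbT leNgt; exact/negP.
    exists n; rewrite /k hx0 mulr0 min_r// mulr0 subr0.
    by apply: le_trans gn _; apply: (cover_fun_le cg); rewrite leq_addr.
by move: h1 h2 sm; rewrite -/s; lra.
Qed.

(** Caratheodory sets form a sigma-algebra, and a half-space [x_i < s] is the positivity set of the
    continuous function [max(0, s - x_i)]. *)
Lemma outer_measurable (A : set (Rd R d)) : measurable A ->
  outer_measure_lam.-caratheodory A.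
Proof.
have sigma_cara : sigma_algebra setT outer_measure_lam.-caratheodory.
  split; first exact: caratheodory_measurable_set0.
    by move=> B; rewrite setTD; exact: caratheodory_measurable_setC.
  exact: caratheodory_measurable_bigcup.
apply: smallest_sub => // U /open_sigma_halfspaces.
apply: smallest_sub => // _ [i [s ->]].
have -> : [set x : T | x ord0 i < s] = [set x | 0 < Num.max 0 (s - x ord0 i)].
  by apply/seteqP; split => x /=; rewrite lt_max ltxx subr_gt0.
apply: outer_caratheodory => [|x]; last by rewrite le_max lexx.
apply: continuous_maxf; first exact: continuous_cstf.
by apply: continuous_subf; [exact: continuous_cstf|exact: coord_continuous].
Qed.

(* Compactness controls a cover on a ball of radius [r], and the sum of the [x_i^2 / r^2],
   which is at least [1] outside the ball, controls the tail. *)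
Lemma outer_setT : outer setT = lam (fun=> 1).
Proof.
apply/eqP; rewrite eq_le; apply/andP; split; first exact/outer_le/cover_cost1.
apply: le_outer => c [g cg gc].
have [gcont Vg g0 _ gT] := cg.
pose q (x : T) : R := \sum_(i < d) x ord0 i * x ord0 i.
have Vcoord i : V (fun x => x ord0 i).
  apply: le_polybounded (polybounded_polyfun (mpoly.mpolyX R (mpoly.mnm1 i))) => x _.
  by rewrite polyfun_coord.
have Vq : V q by apply: polybounded_sum => i; exact: polyboundedM.
have q0 x : 0 <= q x by apply: sumr_ge0 => i _; rewrite -expr2 sqr_ge0.
have lq0 : 0 <= lam q by apply: lam_ge0 => // x _.
have V1 : V (fun=> 1) := polybounded_cst 1.
have l10 : 0 <= lam (fun=> 1) by apply: lam_ge0.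
suff key e : 0 < e -> (1 - e) * lam (fun=> 1) <= c + e.
  apply/ler_addgt0Pr => e e0; pose e' := e / (1 + lam (fun=> 1)).
  have l1 : 0 < 1 + lam (fun=> 1) by lra.
  have e'0 : 0 < e' by rewrite divr_gt0.
  have := key _ e'0; have : e' * (1 + lam (fun=> 1)) = e by rewrite divfK// gt_eqF.
  by lra.
(* Since [r >= 1] and [r e = e + lam q], this radius gives [lam q / r^2 <= e]. *)
move=> e0; pose r := 1 + lam q / e.
have r1 : 1 <= r by rewrite lerDl divr_ge0// ltW.
have qr : (r ^+ 2)^-1 * lam q <= e.
  rewrite ler_pdivrMl ?exprn_gt0//; last exact: lt_le_trans r1.
  have : r * e = e + lam q by rewrite mulrDl mul1r divfK// gt_eqF.
  have : r * e <= r ^+ 2 * e by rewrite ler_pM2r// ler_eXnr.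
  by lra.
have cptC : compact (K `&` [set x | `|x| <= r]).
  apply: bounded_closed_compact.
    exists r; split; first exact: num_real.
    by move=> M rM x [_ /= xr]; apply: le_trans xr (ltW rM).
  apply: closedI => //; apply: (@preimage_closed _ _ _ [set y : R | y <= r]).
    by move=> x _; exact: norm_continuous.
  exact: closed_le.
move: cptC; rewrite compact_cover.
case/(_ nat setT (fun n => [set x | 1 - e < g n x])).
- move=> n _; apply: (@open_comp _ _ (g n) [set y : R | 1 - e < y]).
    by move=> x _; exact: gcont.
  exact: open_gt.
- move=> x [Kx _]; have [n gn] := gT x Kx I; exists n => //=.
  by apply: lt_le_trans gn; rewrite ltrBlDr ltrDl.
move=> D _ CD; pose N := \max_(i <- finmap.enum_fset D) i.
(* Inside the ball the finite subcover and monotonicity of [g] give [1 - e]; outside it, some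
   coordinate attains the sup norm, so [q x / r^2 >= 1]. *)
have gN x : K x -> 1 - e <= g N x + (r ^+ 2)^-1 * q x.
  move=> Kx; have [xr|xr] := leP `|x| r.
    have [n /= nD gn] := CD x (conj Kx xr).
    apply: le_trans (ltW gn) _; apply: le_trans (cover_fun_le cg (m := N) _ _) _.
      by rewrite /N; apply: (leq_bigmax_seq (F := id) n).
    by rewrite lerDl mulr_ge0// invr_ge0 exprn_ge0// (le_trans ler01).
  have [[i j] /= xij] : exists i : 'I_1 * 'I_d, mx_norm x = `|x i.1 i.2|.
    apply: mx_norm_neq0; rewrite gt_eqF//; apply: lt_trans xr.
    exact: lt_le_trans r1.
  have : 1 <= (r ^+ 2)^-1 * q x.
    rewrite ler_pdivlMl ?exprn_gt0//; last exact: lt_le_trans r1.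
    rewrite mulr1 /q (bigD1 j)//= -[leLHS]addr0; apply: lerD; last first.
      by apply: sumr_ge0 => k _; rewrite -expr2 sqr_ge0.
    rewrite -expr2 -[leRHS]real_normK ?num_real//; rewrite (ord1 i) in xij.
    have -> : `|x ord0 j| = `|x| by rewrite -xij.
    apply: lerXn2r; rewrite ?nnegrE ?normr_ge0//; last exact: ltW.
    exact: le_trans r1.
  by have := g0 N x; move: ((r ^+ 2)^-1 * q x) (g N x) => y z; lra.
have : lam (fun x => (1 - e) * 1) <= lam (fun x => g N x + (r ^+ 2)^-1 * q x).
  apply: le_lam => [||x Kx]; last by rewrite mulr1; exact: gN.
    exact: polyboundedZ.
  by apply: polyboundedD => //; exact: polyboundedZ.
rewrite lamZ// lamD ?lamZ//; last exact: polyboundedZ.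
by move/le_trans; apply; apply: lerD.
Qed.

Lemma riesz_sigma_additive :
  semi_sigma_additive (fun A : set (Rd R d) => (outer A)%:E).
Proof.
move=> F mF tF mUF; apply: (@caratheodory_measure_sigma_additive R T outer_measure_lam) => //.
- by move=> i; exact: outer_measurable.
- exact: outer_measurable.
Qed.

Definition riesz_measure : {measure set (Rd R d) -> \bar R} :=
  HB.pack (fun A : set (Rd R d) => (outer A)%:E)
    (isMeasure.Build _ (Rd R d) R (fun A : set (Rd R d) => (outer A)%:E)
      (congr1 EFin outer0) (fun A => outer_ge0 A) riesz_sigma_additive).

(** Covers are constrained on [K] only, so the zero sequence covers the complement. *)
Lemma riesz_setC : riesz_measure (~` K) = 0%E.
Proof.
apply/eqP; rewrite eq_le measure_ge0 andbT lee_fin; apply: outer_le.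
exists (fun _ _ => 0) => [|_]; last by rewrite lam0.
by split => // [_|_]; [exact: continuous_cstf|exact: polybounded_cst].
Qed.

Local Notation nu := riesz_measure.

Let mcont (f : T -> R) : continuous f ->
  measurable_fun (setT : set (Rd R d)) (EFin \o f).
Proof. by move=> cf; apply/measurable_EFinP; exact: continuous_measurable_Rd. Qed.

(* Cut [f] into layers [l i] of height [e]: on the set [A i] where [f >= (i + 1) e] the layer
   [l i] is full, and [l i.+1] vanishes outside [A i]. *)
Lemma riesz_integral_ub f B : continuous f -> V f -> 0 < B ->
  (forall x, 0 <= f x <= B) -> (\int[nu]_x (f x)%:E <= (lam f)%:E)%E.
Proof.
move=> cf Vf B0 fB.
have V1 : V (fun=> 1) := polybounded_cst 1.
have l10 : 0 <= lam (fun=> 1) by apply: lam_ge0.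
suff key M : (\int[nu]_x (f x)%:E <= (B / M.+1%:R * lam (fun=> 1) + lam f)%:E)%E.
  apply/lee_addgt0Pr => e e0.
  pose M := Num.bound (B * lam (fun=> 1) / e).
  apply: le_trans (key M) _; rewrite -EFinD lee_fin addrC lerD2l mulrAC.
  rewrite ler_pdivrMr// [e * _]mulrC -ler_pdivrMr//.
  apply: le_trans (ltW (archi_boundP _)) _; last by rewrite ler_nat.
  by rewrite divr_ge0 ?mulr_ge0// ltW.
pose e := B / M.+1%:R; have e0 : 0 < e by rewrite divr_gt0.
pose l (i : nat) (x : T) := Num.min (Num.max (f x - i%:R * e) 0) e.
have cl i : continuous (l i).
  apply: continuous_minf; last exact: continuous_cstf.
  apply: continuous_maxf; last exact: continuous_cstf.
  by apply: continuous_subf => //; exact: continuous_cstf.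
have l0 i x : 0 <= l i x by rewrite le_min le_max lexx orbT ltW.
have le i x : l i x <= e by rewrite ge_min lexx orbT.
have Vl i : V (l i).
  by apply: le_polybounded (polybounded_cst e) => x _; rewrite !ger0_norm// ltW.
have lsum n x : \sum_(i < n) l i x = Num.min (f x) (n%:R * e).
  have /andP[f0 _] := fB x.
  elim: n => [|n ih]; first by rewrite big_ord0 mul0r min_r.
  rewrite big_ord_recr/= ih /l -natr1 mulrDl mul1r.
  have : 0 <= n%:R * e by rewrite mulr_ge0// ltW.
  move: (n%:R * e) (f x) f0 => a y y0 a0.
  have [ya|ay] := leP y a.
    by rewrite max_r ?subr_le0// min_l ?ltW// addr0 min_l//; lra.
  rewrite max_l ?subr_ge0 ?ltW//; have [h|h] := leP (y - a) e.
    by rewrite min_l; lra.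
  by rewrite min_r; lra.
have fl x : f x = \sum_(i < M.+1) l i x.
  by rewrite lsum min_l// /e mulrC divfK//; have /andP[] := fB x.
pose A i : set (Rd R d) := [set x | i.+1%:R * e <= f x].
have mA i : measurable (A i).
  have mf := continuous_measurable_Rd measurableT cf.
  have := mf measurableT _ (measurable_itv `[i.+1%:R * e, +oo[).
  by rewrite setTI; congr measurable; apply/seteqP; split => x /=; rewrite in_itv/= andbT.
(* The constant sequence [l i / e] covers [A i], because the layer is full there. *)
have nuA i : (e%:E * nu (A i) <= (lam (l i))%:E)%E.
  rewrite -EFinM lee_fin mulrC -ler_pdivlMr//; apply: outer_le.
  exists (fun _ x => e^-1 * l i x); last by move=> _; rewrite lamZ// mulrC.
  split => // [_|_|_ x|x Kx fx].
  - by apply: continuous_mulf => //; exact: continuous_cstf.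
  - exact: polyboundedZ.
  - by rewrite mulr_ge0// invr_ge0 ltW.
  - exists 0%N; rewrite ler_pdivlMl// mulr1 le_min lexx andbT le_max.
    by apply/orP; left; move: fx; rewrite /A/= -natr1 mulrDl mul1r; lra.
have il i : (\int[nu]_x (l i.+1 x)%:E <= (lam (l i))%:E)%E.
  apply: le_trans (nuA i).
  have -> : (e%:E * nu (A i) = \int[nu]_x (e%:E * (\1_(A i) x)%:E))%E.
    rewrite ge0_integralZl_EFin//; last 2 first.
    - exact/measurable_EFinP/measurable_indic.
    - exact: ltW.
    by rewrite integral_indic// setIT.
  apply: ge0_le_integral => //.
  - by move=> x _; rewrite lee_fin.
  - exact: mcont.
  - by apply: emeasurable_funM => //; exact/measurable_EFinP/measurable_indic.
  - move=> x _; rewrite -EFinM lee_fin indicE; case: (boolP (x \in A i)) => [_|].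
      by rewrite mulr1.
    rewrite notin_setE /A/= => /negP; rewrite -ltNge => /ltW fx.
    by rewrite mulr0 ge_min ge_max lexx subr_le0 fx.
(* No set [A] lies below the bottom layer; it is bounded by [e] times the total mass, and this is
   the error term of [key]. *)
have il0 : (\int[nu]_x (l 0%N x)%:E <= (e * lam (fun=> 1))%:E)%E.
  rewrite -outer_setT EFinM -[leRHS](@integral_cst _ _ _ nu setT measurableT e%:E).
  apply: ge0_le_integral => //.
  - by move=> x _; rewrite lee_fin.
  - exact: mcont.
  - by move=> x _; rewrite lee_fin.
under eq_integral do rewrite fl -sumEFin.
rewrite (@ge0_integral_sum _ _ _ nu setT measurableT 'I_M.+1 (fun i x => (l i x)%:E)); last 2 first.
- by move=> i; exact: mcont.
- by move=> i x _; rewrite lee_fin.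
rewrite big_ord_recl EFinD; apply: leeD => //.
(* Each layer [i + 1] is charged to layer [i]; the layers below [M] sum to at most [f]. *)
apply: (@le_trans _ _ (\sum_(i < M) (lam (l i))%:E)%E).
  by apply: lee_sum => i _; exact: il.
rewrite sumEFin lee_fin -lam_sum//; apply: le_lam => //; first exact: polybounded_sum.
by move=> x _; rewrite lsum ge_min lexx.
Qed.

(** The upper bound is also applied to [B - f]; as the total mass is [lam 1], the two inequalities
    add up to an equality. *)
Lemma riesz_integral_bounded f B : continuous f -> V f -> 0 < B ->
  (forall x, 0 <= f x <= B) -> (\int[nu]_x (f x)%:E = (lam f)%:E)%E.
Proof.
move=> cf Vf B0 fB; apply/eqP; rewrite eq_le (riesz_integral_ub cf Vf B0 fB)/=.
have VB : V (fun=> B) := polybounded_cst B.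
have cB : continuous (fun x => B - f x) by apply: continuous_subf => //; exact: continuous_cstf.
have := riesz_integral_ub cB (polyboundedB VB Vf) B0 _.
have Bf x : 0 <= B - f x <= B by have := fB x; lra.
move=> /(_ Bf); rewrite lamB//.
have <- : B * lam (fun=> 1) = lam (fun=> B).
  rewrite -lamZ//; last exact: polybounded_cst.
  by congr lam; apply/funext => x; rewrite mulr1.
have : (\int[nu]_x (f x)%:E + \int[nu]_x (B - f x)%:E = (B * lam (fun=> 1))%:E)%E.
  rewrite -ge0_integralD//; last 4 first.
  - by move=> x _; rewrite lee_fin; have /andP[] := fB x.
  - exact: mcont.
  - by move=> x _; rewrite lee_fin; have /andP[] := Bf x.
  - exact: mcont.
  rewrite -outer_setT EFinM -[RHS](@integral_cst _ _ _ nu setT measurableT B%:E).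
  by apply: eq_integral => x _; rewrite -EFinD addrC subrK.
have : (0 <= \int[nu]_x (f x)%:E)%E.
  by apply: integral_ge0 => x _; rewrite lee_fin; have /andP[] := fB x.
have : (0 <= \int[nu]_x (B - f x)%:E)%E.
  by apply: integral_ge0 => x _; rewrite lee_fin; have /andP[] := Bf x.
case: (\int[nu]_x (f x)%:E)%E => [a| |]//; case: (\int[nu]_x (B - f x)%:E)%E => [b| |]//.
by rewrite !lee_fin -EFinD => _ _ [<-]; lra.
Qed.

(** Truncate at height [n + 1]. Monotone convergence gives one inequality; for the other, the lost
    part costs at most [lam (f^2) / (n + 1)], which is small because [f^2] is still in [V]. *)
Lemma riesz_integral_ge0 f : continuous f -> V f -> (forall x, 0 <= f x) ->
  (\int[nu]_x (f x)%:E = (lam f)%:E)%E.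
Proof.
move=> cf Vf f0; pose t n x := Num.min (f x) n.+1%:R.
have t0 n x : 0 <= t n x by rewrite le_min f0/=.
have ct n : continuous (t n) by apply: continuous_minf => //; exact: continuous_cstf.
have tf n x : t n x <= f x by rewrite ge_min lexx.
have Vt n : V (t n).
  by apply: le_polybounded Vf => x _; rewrite !ger0_norm.
have It n : (\int[nu]_x (t n x)%:E = (lam (t n))%:E)%E.
  apply: (@riesz_integral_bounded _ n.+1%:R) => // x.
  by rewrite t0/= ge_min lexx orbT.
have Vff : V (fun x => f x * f x) by exact: polyboundedM.
apply/eqP; rewrite eq_le; apply/andP; split.
  have cvgI : (\int[nu]_x (t n x)%:E @[n --> \oo] -->
      \int[nu]_x limn (fun n => (t n x)%:E))%E.
    apply: cvg_monotone_convergence => //.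
    - by move=> n; exact: mcont.
    - by move=> n x _; rewrite lee_fin.
    - move=> x _ n m nm; rewrite lee_fin /t le_min ge_min lexx/= ge_min.
      by rewrite ler_nat ltnS nm orbT.
  have fE x : (limn (fun n => (t n x)%:E) = (f x)%:E)%E.
    apply: lim_near_cst => //; exists (Num.bound (f x)) => // n /= fn.
    rewrite /t min_l//; apply: le_trans (ltW (archi_boundP (f0 x))) _.
    by rewrite ler_nat (leq_trans fn).
  move: cvgI; under eq_integral do rewrite fE.
  move=> cvgI; rewrite -(cvg_lim _ cvgI)//; apply: lime_le.
    by apply/cvg_ex; eexists; exact: cvgI.
  by apply: nearW => n; rewrite It lee_fin; exact: le_lam.
apply/lee_addgt0Pr => e e0.
have l0 : 0 <= lam (fun x => f x * f x) by apply: lam_ge0 => // x _; rewrite mulr_ge0.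
pose n := Num.bound (lam (fun x => f x * f x) / e).
apply: (@le_trans _ _ (\int[nu]_x (t n x)%:E + e%:E)%E); last first.
  apply: leeD => //; apply: ge0_le_integral => //.
  - by move=> x _; rewrite lee_fin.
  - exact: mcont.
  - exact: mcont.
  - by move=> x _; rewrite lee_fin.
rewrite It -EFinD lee_fin -lerBlDl -lamB//.
(* With [k] the truncation height, [k (y - k) <= y^2] whenever [y >= k]. *)
apply: (@le_trans _ _ (lam (fun x => n.+1%:R^-1 * (f x * f x)))).
  apply: le_lam; [exact: polyboundedB|exact: polyboundedZ|move=> x _].
  have n0 : 0 < n.+1%:R :> R by [].
  rewrite ler_pdivlMl// /t; move: (n.+1%:R : R) n0 (f x) (f0 x) => k k0 y y0.
  have [yk|ky] := leP y k; first by rewrite subrr mulr0 mulr_ge0.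
  by apply: ler_pM; lra.
rewrite lamZ// ler_pdivrMl// -ler_pdivrMr//.
apply: le_trans (ltW (archi_boundP _)) _; last by rewrite ler_nat.
by rewrite divr_ge0// ltW.
Qed.

Lemma riesz_integral f : continuous f -> V f ->
  nu.-integrable setT (EFin \o f) /\ (\int[nu]_x (f x)%:E = (lam f)%:E)%E.
Proof.
move=> cf Vf.
have cp : continuous (fun x => Num.max (f x) 0).
  by apply: continuous_maxf => //; exact: continuous_cstf.
have cn : continuous (fun x => Num.max (- f x) 0).
  by apply: continuous_maxf; [exact: continuous_oppf|exact: continuous_cstf].
have Vp : V (fun x => Num.max (f x) 0).
  apply: le_polybounded Vf => x _; rewrite ger0_norm ?le_max ?lexx ?orbT//.
  by rewrite ge_max ler_norm normr_ge0.
have Vn : V (fun x => Num.max (- f x) 0).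
  apply: le_polybounded Vf => x _; rewrite ger0_norm ?le_max ?lexx ?orbT//.
  by rewrite ge_max -normrN ler_norm normr_ge0.
split.
  apply/integrableP; split; first exact: mcont.
  have -> : (\int[nu]_x `|(EFin \o f) x| = \int[nu]_x (`|f x|)%:E)%E by [].
  rewrite riesz_integral_ge0 ?ltry//; first exact: continuous_normf.
  by apply: le_polybounded Vf => x _; rewrite normr_id.
rewrite integralE.
have -> : (\int[nu]_x ((fun x => (f x)%:E)^\+ x) = \int[nu]_x (Num.max (f x) 0)%:E)%E.
  by apply: eq_integral => x _; rewrite funeposE EFin_max.
have -> : (\int[nu]_x ((fun x => (f x)%:E)^\- x) = \int[nu]_x (Num.max (- f x) 0)%:E)%E.
  by apply: eq_integral => x _; rewrite funenegE EFin_max.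
rewrite !riesz_integral_ge0//; try by move=> x; rewrite le_max lexx orbT.
rewrite -EFinB -lamB//; congr (lam _)%:E; apply/funext => x.
have [h|h] := leP (f x) 0.
  by rewrite max_l ?oppr_ge0// sub0r opprK.
by rewrite max_r ?oppr_le0 ?subr0// ltW.
Qed.

End Riesz.

(** Positivity on all polynomially bounded functions, quadratic ones included, prevents mass from
    escaping to infinity. *)
Theorem riesz_representation (R : realType) (d : nat) (K : set 'rV[R]_d)
    (lam : ('rV[R]_d -> R) -> R) :
  closed K ->
  (forall f g, polybounded K f -> polybounded K g ->
    lam (fun x => f x + g x) = lam f + lam g) ->
  (forall c f, polybounded K f -> lam (fun x => c * f x) = c * lam f) ->
  (forall f, polybounded K f -> (forall x, K x -> 0 <= f x) -> 0 <= lam f) ->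
  exists nu : {measure set (Rd R d) -> \bar R},
    [/\ (nu setT < +oo)%E, nu (~` K) = 0%E &
      forall f, continuous f -> polybounded K f ->
        nu.-integrable setT (EFin \o f) /\ (\int[nu]_x (f x)%:E = (lam f)%:E)%E].
Proof.
move=> Kcl lamD lamZ lam_ge0; exists (riesz_measure lamD lamZ lam_ge0); split.
- exact: ltry.
- exact: riesz_setC.
- by move=> f; exact: riesz_integral.
Qed.

(** * Extension of moment functionals *)

Section PolyboundedModule.
Context {R : realType} {d : nat}.
Variable K : set 'rV[R]_d.

(** Packaged as a submodule predicate, so that the subtype below inherits the module structure that
    [hahn_banach] expects. *)
Definition polybounded_pred : {pred ('rV[R]_d -> R)} :=
  fun f => `[< polybounded K f >].

Lemma polybounded_submod : submod_closed polybounded_pred.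
Proof.
split=> [|c f g /asboolP Vf /asboolP Vg]; apply/asboolP; first exact: polybounded_cst.
exact: (polyboundedD (polyboundedZ c Vf) Vg).
Qed.

HB.instance Definition _ :=
  GRing.isSubmodClosed.Build R ('rV[R]_d -> R) polybounded_pred polybounded_submod.

Record polybounded_fun := PolyboundedFun {
  polybounded_val :> 'rV[R]_d -> R;
  polybounded_valP : polybounded_val \in polybounded_pred }.

HB.instance Definition _ := [isSub for polybounded_val].
HB.instance Definition _ := [Choice of polybounded_fun by <:].
HB.instance Definition _ := [SubChoice_isSubLmodule of polybounded_fun by <:].

End PolyboundedModule.

Section Supported.
Context {R : realType} {d : nat}.
Implicit Types (mu : {measure set (Rd R d) -> \bar R}) (K : set 'rV[R]_d).

Lemma closed_measurable_Rd K : closed K -> measurable (K : set (Rd R d)).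
Proof.
move=> Kcl; rewrite -[K]setCK; apply: measurableC; apply: sub_sigma_algebra.
exact: closed_openC.
Qed.

Lemma supported_integral mu K (f : Rd R d -> \bar R) : closed K ->
  mu (~` K) = 0%E -> mu.-integrable setT f ->
  (\int[mu]_x f x = \int[mu]_(x in K) f x)%E.
Proof.
move=> Kcl mu0 intf.
have mKC : measurable (~` K : set (Rd R d)).
  by apply: measurableC; exact: closed_measurable_Rd.
by rewrite (negligible_integral mKC)// setTD setCK.
Qed.

End Supported.

(** * Measures with prescribed moments and an extremal integral *)

Section MomentExtension.
Context {R : realType} {d : nat}.
Variables (K : set 'rV[R]_d) (mu : {measure set (Rd R d) -> \bar R}).
Hypothesis Kcl : closed K.
Hypothesis mu_adm : admissible mu K.

Let L (p : mpoly.mpoly d R) : R := fine (\int[mu]_x (polyfun p x)%:E).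

Let intp p : mu.-integrable setT (fun x : Rd R d => (polyfun p x)%:E).
Proof. by have [_ _] := mu_adm; apply. Qed.

Let LE p : (\int[mu]_x (polyfun p x)%:E = (L p)%:E)%E.
Proof. by rewrite fineK// integrable_fin_num. Qed.

Let LD p q : L (p + q) = L p + L q.
Proof.
apply: EFin_inj; rewrite EFinD -!LE -integralD//.
by apply: eq_integral => x _; rewrite polyfunD.
Qed.

Let LZ c p : L (c *: p) = c * L p.
Proof.
apply: EFin_inj; rewrite EFinM -!LE -integralZl//.
by apply: eq_integral => x _; rewrite polyfunZ.
Qed.

Let LN p : L (- p) = - L p.
Proof. by rewrite -scaleN1r LZ mulN1r. Qed.

Let L_le p q : (forall x, K x -> polyfun p x <= polyfun q x) -> L p <= L q.
Proof.
move=> pq; rewrite -lee_fin -!LE !(supported_integral Kcl)//; try by case: mu_adm.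
have mK := closed_measurable_Rd Kcl.
apply: le_integral => //; [exact: (integrableS measurableT)|
  exact: (integrableS measurableT)|].
by move=> x /set_mem Kx; rewrite lee_fin; exact: pq.
Qed.

Let above (f : 'rV[R]_d -> R) : set R :=
  [set L q | q in [set q | forall x, K x -> f x <= polyfun q x]].

Let above_inf f : polybounded K f -> has_inf (above f).
Proof.
move=> [q fq]; split.
  by exists (L q), q => // x Kx; apply: le_trans (ler_norm _) (fq _ Kx).
(* If [q] dominates [|f|] on [K], then [- q] lies below every polynomial that dominates [f]. *)
exists (L (- q)) => _ [r fr <-]; apply: L_le => x Kx; rewrite polyfunN.
by apply: le_trans (fr _ Kx); rewrite lerNl; apply: le_trans (ler_norm _) _; rewrite normrN fq.
Qed.

Let P (f : polybounded_fun K) : R := inf (above f).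

Let pb (f : polybounded_fun K) : polybounded K f.
Proof. by have /asboolP := polybounded_valP f. Qed.

Let P_le (f : polybounded_fun K) q : (forall x, K x -> f x <= polyfun q x) -> P f <= L q.
Proof. by move=> fq; apply: ge_inf; [exact: (above_inf (pb f)).2|exists q]. Qed.

Let P_ge (f : polybounded_fun K) c :
  (forall q, (forall x, K x -> f x <= polyfun q x) -> c <= L q) -> c <= P f.
Proof.
by move=> h; apply: lb_le_inf; [exact: (above_inf (pb f)).1|move=> _ [q fq <-]; exact: h].
Qed.

Let P_sublinear : sublinear P.
Proof.
split=> [f g|t f t0].
  rewrite -lerBlDr; apply: P_ge => p fp; rewrite lerBlDr -lerBlDl.
  apply: P_ge => q gq; rewrite lerBlDl -LD; apply: P_le => x Kx.
  by rewrite polyfunD; apply: lerD; [exact: fp|exact: gq].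
apply/eqP; rewrite eq_le; apply/andP; split.
  rewrite -ler_pdivrMl//; apply: P_ge => q fq.
  rewrite ler_pdivrMl// -LZ; apply: P_le => x Kx.
  by rewrite polyfunZ; apply: ler_wpM2l; [exact: ltW|exact: fq].
apply: P_ge => q fq; rewrite -ler_pdivlMl// -LZ; apply: P_le => x Kx.
by rewrite polyfunZ ler_pdivlMl//; exact: fq.
Qed.

(** Hahn-Banach below [P], with equality at [v], makes the upper extremal value an integral of [v];
    for the opposite function it realizes the lower one. *)
Theorem moment_extension (v : 'rV[R]_d -> R) : continuous v -> polybounded K v ->
  exists nu : {measure set (Rd R d) -> \bar R},
    [/\ admissible nu K, moment_equiv mu nu,
        nu.-integrable setT (fun x : Rd R d => (v x)%:E) &
        (\int[nu]_x (v x)%:E = ereal_inf [set (\int[mu]_x (polyfun q x)%:E)%E | q in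
          [set q : mpoly.mpoly d R | forall x, K x -> (v x <= polyfun q x)%R]])%E].
Proof.
move=> cv Vv.
(* Functions outside the subspace are sent to the default [0]; [mkE] is only used inside it. *)
pose mk f : polybounded_fun K := insubd 0 f.
have mkE f : polybounded K f -> polybounded_val (mk f) = f.
  by move=> Vf; apply: insubdK; exact/asboolP.
have [lam [lamD lamZ lamP lamv]] := hahn_banach (mk v) P_sublinear.
have lamN f : lam (- f) = - lam f by rewrite -scaleN1r lamZ mulN1r.
(* A polynomial dominates itself, so [lam <= P] gives [lam q <= L q]; the same bound for [- q] gives
   equality. *)
have lam_poly q : lam (mk (polyfun q)) = L q.
  apply/eqP; rewrite eq_le; apply/andP; split.
    by apply: le_trans (lamP _) _; apply: P_le => x Kx; rewrite mkE//; exact: polybounded_polyfun.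
  rewrite -lerN2 -lamN -LN; apply: le_trans (lamP _) _; apply: P_le => x Kx.
  by rewrite polyfunN /= mkE//; exact: polybounded_polyfun.
have [||||nu [nuT nuK nuI]] := @riesz_representation R d K (fun f => lam (mk f)).
- exact: Kcl.
- move=> f g Vf Vg; rewrite -lamD; congr lam; apply: val_inj.
  by rewrite /= !mkE//; exact: polyboundedD.
- move=> c f Vf; rewrite -lamZ; congr lam; apply: val_inj.
  by rewrite /= !mkE//; exact: polyboundedZ.
(* The zero polynomial dominates [- f] on [K], hence [P (- f) <= 0]. *)
- move=> f Vf f0; rewrite -lerN2 oppr0 -lamN; apply: le_trans (lamP _) _.
  rewrite -[leRHS](mul0r (L 0)) -LZ; apply: P_le => x Kx.
  by rewrite polyfunZ mul0r /= mkE// oppr_le0 f0.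
have nup q := nuI _ (@continuous_polyfun _ _ q) (polybounded_polyfun q).
exists nu; split.
- split => // [C cC|p]; last by have [] := nup p.
  apply: le_lt_trans nuT; apply: le_measure; rewrite ?inE//.
  apply: closed_measurable_Rd; apply: compact_closed cC; exact: norm_hausdorff.
- by move=> p; have [_ ->] := nup p; rewrite lam_poly LE.
- by have [] := nuI _ cv Vv.
have [_ ->] := nuI _ cv Vv; rewrite lamv /P mkE//.
rewrite -ereal_inf_EFin; [|exact: (above_inf Vv).2|exact: (above_inf Vv).1].
congr ereal_inf; apply/seteqP; split => [_ [_ [q vq <-] <-]|_ [q vq <-]].
  by exists q.
by exists (L q); [exists q|].
Qed.

End MomentExtension.

(** * Uniqueness of the Fantappie transform *)

Section ScalarLimits.
Context {R : realType}.
Implicit Types (u : nat -> R) (l y s t C : R).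

Lemma cvg_le_harmonic u l C N :
  (forall n, (N <= n)%N -> `|u n - l| <= C * n.+1%:R^-1) -> u n @[n --> \oo] --> l.
Proof.
move=> h; apply/cvgrPdist_le => e e0.
exists (maxn N (Num.bound (C / e))) => // n /=; rewrite geq_max => /andP[Nn Cn].
rewrite distrC; apply: le_trans (h n Nn) _.
rewrite ler_pdivrMr// [e * _]mulrC -ler_pdivrMr//.
have [Ce|Ce] := leP 0 (C / e); last by apply: le_trans (ltW Ce) _.
by apply: le_trans (ltW (archi_boundP Ce)) _; rewrite ler_nat (leq_trans Cn).
Qed.

(** The bound is uniform in [n], so it serves as the dominating constant for exponential series. *)
Lemma exp_series_le y n : `|series (exp_coeff y) n| <= expR `|y|.
Proof.
apply: (@le_trans _ _ (series (exp_coeff (`|y| : R)) n)).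
  rewrite /series/=; apply: (le_trans (ler_norm_sum _ _ _)).
  by apply: ler_sum => k _; rewrite /exp_coeff/= normrM normrX normfV normr_nat.
have nd : nondecreasing_seq (series (exp_coeff `|y|)).
  apply/nondecreasing_seqP => k; rewrite /series/= big_nat_recr//= lerDl.
  by rewrite /exp_coeff/= divr_ge0// exprn_ge0.
exact: (nondecreasing_cvgn_le nd (is_cvg_series_exp_coeff (`|y| : R))).
Qed.

Lemma expR_le_inv t : 0 <= t -> expR (- t) <= (1 + t)^-1.
Proof. by move=> t0; rewrite expRN lef_pV2 ?posrE ?expR_gt0 ?expR_ge1Dx//; lra. Qed.

(* A limit of polynomials in [expR y] approximates the indicator of [y < s]; the summand
   [n%:R] forces the limit [0] at [y = s]. *)
Lemma cvg_gumbel y s :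
  expR (- expR (n%:R ^+ 2 * (y - s) + n%:R)) @[n --> \oo] --> ((y < s)%R%:R : R).
Proof.
have n1 n : 0 < 1 + n%:R :> R by rewrite nat1r.
have [ys|sy] := ltP y s.
  (* For [n >= N] one has [n (s - y) >= 2], so the inner exponent is at most [- n]. *)
  pose N := Num.bound (2 / (s - y)).
  apply: (@cvg_le_harmonic _ _ 1 N) => n Nn.
  have sy0 : 0 < s - y by rewrite subr_gt0.
  have hn : 2 <= n%:R * (s - y).
    rewrite -ler_pdivrMr//; apply: le_trans (ltW (archi_boundP _)) _; last by rewrite ler_nat.
    by rewrite divr_ge0// ltW.
  set t := expR (_ + _).
  have t0 : 0 < t by exact: expR_gt0.
  have et1 : expR (- t) <= 1 by rewrite expR_le1 oppr_le0 ltW.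
  have et : 1 - t <= expR (- t) by have := expR_ge1Dx (- t).
  have tn : t <= (1 + n%:R)^-1.
    apply: le_trans (@expR_le_inv n%:R _) => //; rewrite /t ler_expR.
    have : n%:R * 2 <= n%:R * (n%:R * (s - y)) by rewrite ler_wpM2l.
    by move: (n%:R : R) => k; rewrite expr2; lra.
  rewrite mul1r -natr1 [n%:R + 1]addrC distrC mulr1n ger0_norm ?subr_ge0//.
  by move: et1 et tn; move: (expR (- t)) ((1 + n%:R)^-1) => a b; lra.
apply: (@cvg_le_harmonic _ _ 1 0) => n _.
rewrite subr0 mul1r ger0_norm ?expR_ge0//.
apply: le_trans (expR_le_inv (expR_ge0 _)) _.
rewrite lef_pV2 ?posrE ?addr_gt0 ?expR_gt0// -natr1 [leRHS]addrC lerD2r.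
apply: le_trans (expR_ge1Dx _).
have : 0 <= n%:R ^+ 2 * (y - s) by rewrite mulr_ge0 ?subr_ge0// exprn_ge0.
lra.
Qed.

(** With [u = y / k], squeeze by [1 + u <= expR u <= 1 / (1 - u)]; the upper error is
    [y^2 / (k - y) <= 1 / (k - 1)]. Taking [k = n + 2] keeps [k - 1] positive. This recovers a
    linear function from exponentials. *)
Lemma expR_diff_quotient y n : 0 <= y <= 1 ->
  0 <= n.+2%:R * (expR (y / n.+2%:R) - 1) - y <= n.+1%:R^-1.
Proof.
move=> /andP[y0 y1]; set k := n.+2%:R.
have -> : n.+1%:R = k - 1 :> R by rewrite /k -[n.+2%:R]natr1 addrK.
have k2 : 2 <= k by rewrite ler_nat.
have k0 : 0 < k by lra.
move: k k2 k0 => k k2 k0.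
have hy : k * (y / k) = y by rewrite mulrC divfK// gt_eqF.
have hyk : y / k <= 1 / 2 by rewrite ler_pdivrMr//; lra.
have l1 : 1 + y / k <= expR (y / k) by exact: expR_ge1Dx.
have l2 : expR (y / k) <= (1 - y / k)^-1.
  rewrite -[leLHS]invrK lef_pV2 ?posrE ?invr_gt0 ?expR_gt0//; last by lra.
  by rewrite -expRN; have := expR_ge1Dx (- (y / k)).
have e2 : k * ((1 - y / k)^-1 - 1) - y = y ^+ 2 / (k - y).
  by field; apply/andP; split; rewrite gt_eqF//; lra.
apply/andP; split.
  have : 0 <= k * (expR (y / k) - 1 - y / k) by rewrite mulr_ge0//; lra.
  by rewrite [X in 0 <= X -> _]mulrBr hy.
apply: (@le_trans _ _ (k * ((1 - y / k)^-1 - 1) - y)).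
  by rewrite lerD2r ler_pM2l// lerD2r.
rewrite e2; apply: (@le_trans _ _ (1 / (k - 1))); last by rewrite div1r.
apply: ler_pM; rewrite ?sqr_ge0//.
- by rewrite invr_ge0; lra.
- by rewrite expr_le1.
- by rewrite lef_pV2 ?posrE; lra.
Qed.

Lemma small_mul (u v t r : R) : 0 < r -> 0 <= u -> 0 <= v -> 0 <= t ->
  t * (2 * (u + 1)) <= 1 -> t * (2 * (v + 1)) <= r -> t * u <= 1 / 2 /\ t * v < r.
Proof. by move=> r0 u0 v0 t0 h1 h2; split; nra. Qed.

End ScalarLimits.

Section DotProduct.
Context {R : realType} {d : nat}.
Implicit Types a b c x : 'rV[R]_d.

Lemma dotpDl a b x : dotp (a + b) x = dotp a x + dotp b x.
Proof. by rewrite -big_split/=; apply: eq_bigr => i _; rewrite mxE mulrDl. Qed.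

Lemma dotpZl (t : R) a x : dotp (t *: a) x = t * dotp a x.
Proof. by rewrite mulr_sumr; apply: eq_bigr => i _; rewrite mxE mulrA. Qed.

Lemma dotp_delta i x : dotp (delta_mx ord0 i) x = x ord0 i.
Proof.
rewrite /dotp (bigD1 i)//= mxE !eqxx mul1r big1 ?addr0// => j ji.
by rewrite mxE (negbTE ji) andbF mul0r.
Qed.

Lemma dotp_norm_le a x : `|dotp a x| <= `|a| * \sum_(i < d) `|x ord0 i|.
Proof.
apply: le_trans (ler_norm_sum _ _ _) _; rewrite mulr_sumr.
apply: ler_sum => i _; rewrite normrM ler_wpM2r//.
have -> : `|a| = mx_norm a by []; rewrite mx_normrE.
exact: (le_bigmax_cond 0 (fun ij : 'I_1 * 'I_d => `|a ij.1 ij.2|) (j := (ord0, i))).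
Qed.

Lemma continuous_dotp a : continuous (dotp a).
Proof.
apply: continuous_sumf => i; apply: continuous_mulf; first exact: continuous_cstf.
exact: coord_continuous.
Qed.

End DotProduct.

(** * Finite measures whose transforms agree near a point [b] *)

Section Uniqueness.
Context {R : realType} {d : nat}.
Variables (K : set 'rV[R]_d) (mu nu : {measure set (Rd R d) -> \bar R}).
Hypothesis Kcl : closed K.
Hypotheses (muK : (mu K < +oo)%E) (nuK : (nu K < +oo)%E).
Implicit Types (f g h : 'rV[R]_d -> R) (c x : 'rV[R]_d).

Let mK : measurable (K : set (Rd R d)) := closed_measurable_Rd Kcl.

Definition bounded_measurable g :=
  measurable_fun (K : set (Rd R d)) (g : Rd R d -> R) /\
  exists B, forall x, K x -> `|g x| <= B.
Local Notation bm := bounded_measurable.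

Definition same_integral g :=
  (\int[mu]_(x in K) (g x)%:E = \int[nu]_(x in K) (g x)%:E)%E.
Local Notation same := same_integral.

Lemma bm_continuous g B : continuous g -> (forall x, K x -> `|g x| <= B) -> bm g.
Proof. by move=> cg gB; split; [exact: continuous_measurable_Rd|exists B]. Qed.

Lemma bm_cst k : bm (fun=> k).
Proof. by split; [exact: measurable_cst|exists `|k|]. Qed.

Lemma bmD f g : bm f -> bm g -> bm (fun x => f x + g x).
Proof.
move=> [mf [B fB]] [mg [C gC]]; split; first exact: measurable_funD.
by exists (B + C) => x Kx; apply: le_trans (ler_normD _ _) _; rewrite lerD ?fB ?gC.
Qed.

Lemma bmM f g : bm f -> bm g -> bm (fun x => f x * g x).
Proof.
move=> [mf [B fB]] [mg [C gC]]; split; first exact: measurable_funM.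
by exists (B * C) => x Kx; rewrite normrM ler_pM ?fB ?gC.
Qed.

Lemma bmZ k f : bm f -> bm (fun x => k * f x).
Proof. exact/bmM/bm_cst. Qed.

Lemma bm_ext f g : (forall x, K x -> f x = g x) -> bm f -> bm g.
Proof.
move=> fg [mf [B fB]]; split; last by exists B => x Kx; rewrite -fg// fB.
by apply: eq_measurable_fun mf => x /set_mem Kx; exact: fg.
Qed.

Lemma bm_lim (g : nat -> 'rV[R]_d -> R) f B : (forall n, bm (g n)) ->
  (forall n x, K x -> `|g n x| <= B) ->
  (forall x, K x -> g n x @[n --> \oo] --> f x) -> bm f.
Proof.
move=> bg gB gf; split.
  by apply: (@measurable_fun_cvg _ (Rd R d) R K g f) => // n; have [] := bg n.
exists B => x Kx; have cn : `|g n x| @[n --> \oo] --> `|f x| by exact: cvg_norm (gf x Kx).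
rewrite -(cvg_lim _ cn)//; apply: limr_le; first by apply/cvg_ex; exists `|f x|.
by apply: nearW => n; exact: gB.
Qed.

Let bm_int (la : {measure set (Rd R d) -> \bar R}) f : (la K < +oo)%E -> bm f ->
  la.-integrable K (EFin \o f).
Proof.
move=> laK [mf [B fB]]; apply: measurable_bounded_integrable => //.
exists B; split; first exact: num_real.
by move=> M BM x Kx; apply: le_trans (fB _ Kx) (ltW BM).
Qed.

Lemma sameD f g : bm f -> bm g -> same f -> same g -> same (fun x => f x + g x).
Proof.
move=> bf bg sf sg; rewrite /same; under eq_integral do rewrite EFinD.
under [RHS]eq_integral do rewrite EFinD.
by rewrite !integralD//; try exact: bm_int; rewrite sf sg.
Qed.

Lemma sameZ k f : bm f -> same f -> same (fun x => k * f x).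
Proof.
move=> bf sf; rewrite /same; under eq_integral do rewrite EFinM.
under [RHS]eq_integral do rewrite EFinM.
by rewrite !integralZl//; try exact: bm_int; rewrite sf.
Qed.

Lemma same_ext f g : (forall x, K x -> f x = g x) -> same f -> same g.
Proof.
move=> fg; suff e (la : {measure set (Rd R d) -> \bar R}) :
    (\int[la]_(x in K) (f x)%:E = \int[la]_(x in K) (g x)%:E)%E.
  by rewrite /same !e.
by apply: eq_integral => x /set_mem Kx; rewrite fg.
Qed.

Lemma same_lim (g : nat -> 'rV[R]_d -> R) f B : (forall n, bm (g n)) ->
  (forall n x, K x -> `|g n x| <= B) ->
  (forall x, K x -> g n x @[n --> \oo] --> f x) ->
  (forall n, same (g n)) -> same f.
Proof.
move=> bg gB gf sg.
have cvgI (la : {measure set (Rd R d) -> \bar R}) : (la K < +oo)%E ->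
    (\int[la]_(x in K) (g n x)%:E @[n --> \oo] --> \int[la]_(x in K) (f x)%:E)%E.
  move=> laK; apply: (@dominated_cvg _ _ _ la _ mK _ _ (cst B%:E)) => //.
  - by move=> n; apply/measurable_EFinP; have [] := bg n.
  - by move=> x Kx; apply: cvg_EFin; [exact: nearW|exact: gf].
  - by apply: (bm_int laK); exact: bm_cst.
rewrite /same -(cvg_lim _ (cvgI _ muK))// -(cvg_lim _ (cvgI _ nuK))//.
suff -> : (fun n => \int[mu]_(x in K) (g n x)%:E)%E =
  (fun n => \int[nu]_(x in K) (g n x)%:E)%E by [].
by apply/funext => n; exact: sg.
Qed.

Variables (b : 'rV[R]_d) (eps r : R).
Hypotheses (eps_gt0 : 0 < eps) (r_gt0 : 0 < r).
Hypothesis bK : forall x, K x -> eps * \sum_(i < d) `|x ord0 i| <= dotp b x.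
Hypothesis sameF : forall c, `|c| < r -> same (fun x => (dotp (b + c) x + 1)^-1).

(* The absolute value is immaterial on [K]; it makes [weight] continuous everywhere. On [K],
   [proj c x] is [(c.x) / (1 + b.x)], which is bounded. *)
Definition weight x : R := (1 + `|dotp b x|)^-1.
Definition proj c x : R := dotp c x * weight x.
Local Notation z := proj.
Let C c := `|c| / eps.
Let G c (t : R) x : R := (1 + `|dotp (b + t *: c) x|)^-1.

Let C_ge0 c : 0 <= C c. Proof. by rewrite divr_ge0// ltW. Qed.

Let b_ge0 x : K x -> 0 <= dotp b x.
Proof.
move=> Kx; apply: le_trans (bK Kx); rewrite mulr_ge0 ?(ltW eps_gt0)//.
by apply: sumr_ge0 => i _.
Qed.

Let dotp_bound c x : K x -> `|dotp c x| <= C c * dotp b x.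
Proof.
move=> Kx; apply: le_trans (dotp_norm_le _ _) _.
by rewrite -mulrA ler_wpM2l// ler_pdivlMl//; exact: bK.
Qed.

Let den_gt0 (y : R) : 0 < 1 + `|y|. Proof. by rewrite ltr_pwDl. Qed.

Let inv_den (y : R) : 0 < (1 + `|y|)^-1 <= 1.
Proof. by rewrite invr_gt0 den_gt0/= invf_le1// lerDl. Qed.

Let continuous_inv_den c : continuous (fun x => (1 + `|dotp c x|)^-1).
Proof.
apply: continuous_invf => [x|]; first by rewrite gt_eqF.
apply: continuous_addf; first exact: continuous_cstf.
by apply: continuous_normf; exact: continuous_dotp.
Qed.

Let bm_inv_den c : bm (fun x => (1 + `|dotp c x|)^-1).
Proof.
apply: (@bm_continuous _ 1) => [|x _]; first exact: continuous_inv_den.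
by have /andP[h1 h2] := inv_den (dotp c x); rewrite ger0_norm// ltW.
Qed.

Lemma bm_weight : bm weight. Proof. exact: bm_inv_den. Qed.

Let weightE x : K x -> weight x = (1 + dotp b x)^-1.
Proof. by move=> Kx; rewrite /weight ger0_norm// b_ge0. Qed.

Lemma proj_bound c x : K x -> `|z c x| <= C c.
Proof.
move=> Kx; rewrite normrM weightE//; have b0 := b_ge0 Kx.
rewrite [X in _ * X]ger0_norm ?invr_ge0; last by lra.
rewrite ler_pdivrMr; last by lra.
by apply: le_trans (dotp_bound c Kx) _; rewrite ler_wpM2l// lerDr.
Qed.

Lemma continuous_proj c : continuous (z c).
Proof. by apply: continuous_mulf; [exact: continuous_dotp|exact: continuous_inv_den]. Qed.

Lemma bm_proj c : bm (z c).
Proof. by apply: (@bm_continuous _ (C c)); [exact: continuous_proj|exact: proj_bound]. Qed.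

Lemma projD c e x : z (c + e) x = z c x + z e x.
Proof. by rewrite /proj dotpDl mulrDl. Qed.

Lemma projZ (k : R) c x : z (k *: c) x = k * z c x.
Proof. by rewrite /proj dotpZl mulrA. Qed.

Lemma bmX f n : bm f -> bm (fun x => f x ^+ n).
Proof.
move=> bf; elim: n => [|n ih]; first by under eq_fun do rewrite expr0; exact: bm_cst.
by under eq_fun do rewrite exprS; exact: bmM.
Qed.

(** For such [t], [|t c.x| <= (b.x) / 2] on [K], so the perturbed denominator stays positive, and
    [b + t c] stays where [sameF] applies. *)
Let small_scale c : exists2 t0 : R, 0 < t0 &
  forall t, `|t| <= t0 -> `|t| * C c <= 1 / 2 /\ `|t *: c| < r.
Proof.
have Cc := C_ge0 c; have nc := normr_ge0 c.
have [q0 q1] : 0 < 2 * (C c + 1) /\ 0 < 2 * (`|c| + 1) by split; lra.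
exists (Num.min (1 / (2 * (C c + 1))) (r / (2 * (`|c| + 1)))).
  by rewrite lt_min !divr_gt0.
move=> t; rewrite le_min normrZ => /andP[].
by rewrite (ler_pdivlMr _ _ q0) (ler_pdivlMr _ _ q1); exact: small_mul.
Qed.

(** The expansion is carried out without derivatives. The identity [G_0 - G_t = t z_c G_t] expresses
    [z_c^(m+1) G_t] through [z_c^m G_0] and [z_c^m G_t] when [t] is nonzero; letting [t] tend to [0]
    completes the induction on [m], and [G_0] is the weight. *)
Let same_proj_pow c n : same (fun x => z c x ^+ n * weight x).
Proof.
have [t0 t0_gt0 small] := small_scale c.
have den t x : K x -> `|t| <= t0 -> 0 < 1 + dotp b x + t * dotp c x.
  move=> Kx /small[tC _]; have := dotp_bound c Kx; have b0 := b_ge0 Kx.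
  move=> /(ler_wpM2l (normr_ge0 t)); rewrite -normrM mulrA.
  have : `|t| * C c * dotp b x <= 1 / 2 * dotp b x by rewrite ler_wpM2r.
  by have := ler_norm (- (t * dotp c x)); rewrite normrN; lra.
have GE t x : K x -> `|t| <= t0 -> G c t x = (1 + dotp b x + t * dotp c x)^-1.
  move=> Kx tt; rewrite /G dotpDl dotpZl ger0_norm ?addrA//.
  have [tC _] := small t tt; have := dotp_bound c Kx; have b0 := b_ge0 Kx.
  move=> /(ler_wpM2l (normr_ge0 t)); rewrite -normrM mulrA.
  have : `|t| * C c * dotp b x <= 1 / 2 * dotp b x by rewrite ler_wpM2r.
  by have := ler_norm (- (t * dotp c x)); rewrite normrN; lra.
have t00 : `|0 : R| <= t0 by rewrite normr0 ltW.
have bmG t : bm (G c t) by exact: bm_inv_den.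
have bmzG m t : bm (fun x => z c x ^+ m * G c t x).
  by apply: bmM => //; apply: bmX; exact: bm_proj.
have zE x : K x -> z c x = dotp c x / (1 + dotp b x).
  by move=> Kx; rewrite /proj weightE.
have diffG t x : K x -> `|t| <= t0 -> G c 0 x - G c t x = t * (z c x * G c t x).
  move=> Kx tt; rewrite !GE// zE// mul0r addr0.
  have b1 : 1 + dotp b x != 0 by rewrite gt_eqF//; have := b_ge0 Kx; lra.
  have b2 : 1 + dotp b x + t * dotp c x != 0 by rewrite gt_eqF// den.
  by field; rewrite b1 b2.
suff key m t : `|t| <= t0 -> same (fun x => z c x ^+ m * G c t x).
  apply: same_ext (key n 0 t00) => x Kx.
  by rewrite GE// mul0r addr0 weightE.
elim: m t => [|m ih] t tt.
  apply: same_ext (sameF (small t tt).2) => x Kx.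
  by rewrite expr0 mul1r GE// dotpDl dotpZl addrC addrA.
have key0 : forall t, `|t| <= t0 -> t != 0 ->
    same (fun x => z c x ^+ m.+1 * G c t x).
  move=> s ss s0; apply: (@same_ext (fun x => s^-1 *
    (z c x ^+ m * G c 0 x + (-1) * (z c x ^+ m * G c s x)))).
    move=> x Kx; rewrite mulN1r -mulrBr diffG// exprSr.
    by field.
  apply: sameZ; first by apply: bmD => //; exact: bmZ.
  apply: sameD => //; [exact: bmZ|exact: ih|].
  by apply: sameZ => //; exact: ih.
have [->|] := eqVneq t 0; last exact: key0.
(* Nonzero scales tending to [0]; by [diffG] the error at [s j] is at most
   [C^(m+2) t0 / (j + 1)]. *)
pose s (j : nat) := t0 / j.+1%:R.
have s_gt0 j : 0 < s j by rewrite divr_gt0.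
have s_le j : `|s j| <= t0.
  by rewrite gtr0_norm// ler_pdivrMr// ler_peMr ?ler1n// ltW.
have GB u x : `|G c u x| <= 1.
  by have /andP[h1 h2] := inv_den (dotp (b + u *: c) x); rewrite ger0_norm// ltW.
have zB x k : K x -> `|z c x ^+ k| <= C c ^+ k.
  by move=> Kx; rewrite normrX lerXn2r ?nnegrE// proj_bound.
apply: (@same_lim (fun j x => z c x ^+ m.+1 * G c (s j) x) _ (C c ^+ m.+1)) => //.
- by move=> j x Kx; rewrite normrM -[leRHS]mulr1 ler_pM ?zB.
- move=> x Kx; apply: (@cvg_le_harmonic _ _ _ (C c ^+ m.+2 * t0) 0) => j _.
  rewrite -mulrBr -normrN -mulrN opprB diffG//.
  rewrite [X in `|X|](_ : _ = z c x ^+ m.+2 * s j * G c (s j) x); last first.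
    by rewrite [in RHS]exprSr; ring.
  rewrite 2!normrM (ger0_norm (ltW (s_gt0 j))) -mulrA -[_ * t0 * _]mulrA.
  apply: ler_pM; rewrite ?zB// ?mulr_ge0// ?(ltW (s_gt0 j))//.
    exact: ltW.
  by apply: (ler_piMr (ltW (s_gt0 j))); exact: GB.
- by move=> j; apply: key0 => //; rewrite gt_eqF.
Qed.

Let E c x : R := expR (z c x).

Let E_bound c x : K x -> `|E c x| <= expR (C c).
Proof.
move=> Kx; rewrite ger0_norm ?expR_ge0// ler_expR.
exact: le_trans (ler_norm _) (proj_bound c Kx).
Qed.

Let bmE c : bm (E c).
Proof.
apply: (@bm_continuous _ (expR (C c))); last exact: E_bound.
move=> x; apply: (@continuous_comp _ _ _ (z c) expR); first exact: continuous_proj.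
exact: continuous_expR.
Qed.

Let weight_bound x : `|weight x| <= 1.
Proof. by have /andP[h1 h2] := inv_den (dotp b x); rewrite ger0_norm// ltW. Qed.

Lemma bm_exp_series f n : bm f -> bm (fun x => series (exp_coeff (f x)) n).
Proof.
move=> bf; elim: n => [|n ih].
  by under eq_fun do rewrite /series/= big_geq//; exact: bm_cst.
under eq_fun do rewrite seriesSr.
by apply: bmD => //; apply: bmM; [exact: bmX|exact: bm_cst].
Qed.

Let same_exp c : same (fun x => E c x * weight x).
Proof.
have bmS n : bm (fun x => series (exp_coeff (z c x)) n * weight x).
  by apply: bmM; [exact/bm_exp_series/bm_proj|exact: bm_weight].
apply: (@same_lim (fun n x => series (exp_coeff (z c x)) n * weight x) _ (expR (C c))) => //.
- move=> n x Kx; rewrite normrM -[leRHS]mulr1 ler_pM ?weight_bound//.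
  by apply: le_trans (exp_series_le _ _) _; rewrite ler_expR proj_bound.
- by move=> x Kx; apply: cvgM; [exact: is_cvg_series_exp_coeff|exact: cvg_cst].
elim=> [|n ih].
  apply: (@same_ext (fun=> 0)) => [x _|]; first by rewrite /series/= big_geq// mul0r.
  by rewrite /same !integral0.
apply: (@same_ext (fun x => series (exp_coeff (z c x)) n * weight x +
    (n`!%:R)^-1 * (z c x ^+ n * weight x))).
  by move=> x Kx; rewrite seriesSr mulrDl /exp_coeff/=; ring.
have bp : bm (fun x => z c x ^+ n * weight x).
  by apply: bmM; [exact/bmX/bm_proj|exact: bm_weight].
by apply: sameD => //; [exact: bmZ|exact: sameZ].
Qed.

(* The multipliers of the class of tested functions form an algebra closed under bounded
   limits, which contains the exponentials [E c]. *)
Definition tested h := bm h /\ forall c, same (fun x => h x * (E c x * weight x)).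

Definition multiplier g := bm g /\ forall h, tested h -> tested (fun x => h x * g x).

Let bmEw c : bm (fun x => E c x * weight x).
Proof. by apply: bmM; [exact: bmE|exact: bm_weight]. Qed.

Lemma tested1 : tested (fun=> 1).
Proof.
split; first exact: bm_cst.
by move=> c; apply: same_ext (same_exp c) => x _; rewrite mul1r.
Qed.

Lemma testedD f g : tested f -> tested g -> tested (fun x => f x + g x).
Proof.
move=> [bf sf] [bg sg]; split=> [|c]; first exact: bmD.
apply: same_ext (sameD _ _ (sf c) (sg c)); try exact: bmM.
by move=> x _; rewrite mulrDl.
Qed.

Lemma testedZ k f : tested f -> tested (fun x => k * f x).
Proof.
move=> [bf sf]; split=> [|c]; first exact: bmZ.
apply: same_ext (sameZ k _ (sf c)); try exact: bmM.
by move=> x _; rewrite mulrA.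
Qed.

Lemma tested_ext f g : (forall x, K x -> f x = g x) -> tested f -> tested g.
Proof.
move=> fg [bf sf]; split=> [|c]; first exact: bm_ext bf.
by apply: same_ext (sf c) => x Kx; rewrite fg.
Qed.

Lemma tested_lim (g : nat -> 'rV[R]_d -> R) f B :
  (forall n x, K x -> `|g n x| <= B) ->
  (forall x, K x -> g n x @[n --> \oo] --> f x) ->
  (forall n, tested (g n)) -> tested f.
Proof.
move=> gB gf tg; split=> [|c]; first by apply: bm_lim gB gf => n; have [] := tg n.
apply: (@same_lim (fun n x => g n x * (E c x * weight x)) _ (B * (expR (C c) * 1))).
- by move=> n; apply: bmM => //; have [] := tg n.
- move=> n x Kx; rewrite !normrM; apply: ler_pM => //; rewrite ?mulr_ge0//; first exact: gB.
  by apply: ler_pM => //; exact: E_bound.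
- by move=> x Kx; apply: cvgM; [exact: gf|exact: cvg_cst].
- by move=> n; have [] := tg n.
Qed.

Lemma multiplier_ext f g : (forall x, K x -> f x = g x) -> multiplier f -> multiplier g.
Proof.
move=> fg [bf mf]; split=> [|h th]; first exact: bm_ext bf.
by apply: tested_ext (mf h th) => x Kx; rewrite fg.
Qed.

Lemma multiplier_cst k : multiplier (fun=> k).
Proof.
split=> [|h th]; first exact: bm_cst.
by apply: tested_ext (testedZ k th) => x _; rewrite mulrC.
Qed.

Lemma multiplierD f g : multiplier f -> multiplier g -> multiplier (fun x => f x + g x).
Proof.
move=> [bf mf] [bg mg]; split=> [|h th]; first exact: bmD.
by apply: tested_ext (testedD (mf h th) (mg h th)) => x _; rewrite mulrDr.
Qed.

Lemma multiplierM f g : multiplier f -> multiplier g -> multiplier (fun x => f x * g x).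
Proof.
move=> [bf mf] [bg mg]; split=> [|h th]; first exact: bmM.
by apply: tested_ext (mg _ (mf h th)) => x _; rewrite mulrA.
Qed.

Lemma multiplierB f g : multiplier f -> multiplier g -> multiplier (fun x => f x - g x).
Proof.
move=> mf mg; apply: multiplier_ext (multiplierD mf (multiplierM (multiplier_cst (-1)) mg)).
by move=> x _; rewrite mulN1r.
Qed.

Lemma multiplierX f n : multiplier f -> multiplier (fun x => f x ^+ n).
Proof.
move=> mf; elim: n => [|n ih]; first by under eq_fun do rewrite expr0; exact: multiplier_cst.
by under eq_fun do rewrite exprS; exact: multiplierM.
Qed.

Lemma multiplier_lim (g : nat -> 'rV[R]_d -> R) f B :
  (forall n x, K x -> `|g n x| <= B) ->
  (forall x, K x -> g n x @[n --> \oo] --> f x) ->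
  (forall n, multiplier (g n)) -> multiplier f.
Proof.
move=> gB gf mg; split=> [|h th]; first by apply: bm_lim gB gf => n; have [] := mg n.
have [[mh [D hD]] _] := th.
apply: (@tested_lim (fun n x => h x * g n x) _ (D * B)).
- by move=> n x Kx; rewrite normrM; apply: ler_pM => //; [exact: hD|exact: gB].
- by move=> x Kx; apply: cvgM; [exact: cvg_cst|exact: gf].
- by move=> n; have [_] := mg n; apply.
Qed.

(** As [z] is additive in its index, [E c * E e = E (c + e)]; this is why [tested] quantifies over
    every exponential. *)
Lemma multiplier_E c : multiplier (E c).
Proof.
split=> [|h [bh sh]]; first exact: bmE.
split=> [|e]; first exact: bmM.
apply: same_ext (sh (c + e)) => x _.
by rewrite /E projD expRD; ring.
Qed.

Lemma multiplier_expR f : multiplier f -> multiplier (fun x => expR (f x)).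
Proof.
move=> mf; have [[_ [B fB]] _] := mf.
apply: (@multiplier_lim (fun n x => series (exp_coeff (f x)) n) _ (expR B)).
- by move=> n x Kx; apply: le_trans (exp_series_le _ _) _; rewrite ler_expR fB.
- by move=> x Kx; exact: is_cvg_series_exp_coeff.
elim=> [|n ih].
  by under eq_fun do rewrite /series/= big_geq//; exact: multiplier_cst.
under eq_fun do rewrite seriesSr.
by apply: multiplierD => //; apply: multiplierM; [exact: multiplierX|exact: multiplier_cst].
Qed.

Lemma multiplier_halfspace c (s : R) : multiplier (fun x => (z c x < s)%R%:R).
Proof.
apply: (@multiplier_lim
  (fun n x => expR (- expR (n%:R ^+ 2 * (z c x - s) + n%:R))) _ 1).
- by move=> n x _; rewrite ger0_norm ?expR_ge0// expR_le1 oppr_le0 expR_ge0.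
- by move=> x _; exact: cvg_gumbel.
move=> n; apply: multiplier_expR.
(* The inner exponential of [cvg_gumbel] is the constant [expR (n - n^2 s)] times [E (n^2 c)]. *)
apply: multiplier_ext (multiplierM (multiplier_cst (- expR (n%:R - n%:R ^+ 2 * s)))
  (multiplier_E (n%:R ^+ 2 *: c))) => x _.
by rewrite /E projZ mulNr -expRD; congr (- expR _); ring.
Qed.

(** The function [z b] is the bounded limit of the difference quotients [k (E (b / k) - 1)], as its
    values on [K] lie in [[0, 1]]. *)
Lemma multiplier_projb : multiplier (z b).
Proof.
have zb x : K x -> 0 <= z b x <= 1.
  move=> Kx; rewrite /proj weightE//; have b0 := b_ge0 Kx.
  by rewrite divr_ge0//=; [rewrite ler_pdivrMr|]; lra.
apply: (@multiplier_lim
  (fun n x => n.+2%:R * (expR (z b x / n.+2%:R) - 1)) _ 2).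
- move=> n x Kx; have zb1 := zb x Kx.
  have /andP[h1 h2] := expR_diff_quotient n zb1.
  have h3 : n.+1%:R^-1 <= 1 :> R by rewrite invf_le1// ler1n.
  move: h1 h2 zb1 => h1 h2 /andP[z0 z1]; rewrite ger0_norm.
    by move: h2 h3 z1; move: (n.+1%:R^-1 : R) (z b x) (n.+2%:R * _) => p q u; lra.
  by move: h1 z0; move: (z b x) (n.+2%:R * _) => q u; lra.
- move=> x Kx; apply: (@cvg_le_harmonic _ _ _ 1 0) => n _.
  by have /andP[h1 h2] := expR_diff_quotient n (zb x Kx); rewrite ger0_norm// mul1r.
move=> n; apply: multiplierM; first exact: multiplier_cst.
apply: multiplierB; last exact: multiplier_cst.
apply: multiplier_ext (multiplier_E (n.+2%:R^-1 *: b)) => x _.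
by rewrite /E projZ mulrC.
Qed.

Let multiplier_setU (A B : set 'rV[R]_d) :
  multiplier \1_A -> multiplier \1_B -> multiplier \1_(A `|` B).
Proof.
move=> mA mB; apply: multiplier_ext (multiplierB (multiplierD mA mB) (multiplierM mA mB)).
move=> x _; rewrite !indicE in_setU.
by case: (x \in A); case: (x \in B); rewrite /= ?mulr1n ?mulr0n; ring.
Qed.

(** Multipliers form an algebra closed under bounded limits, so the sets whose indicator is a
    multiplier form a sigma-algebra; it remains to treat half-spaces. *)
Lemma multiplier_indic (U : set (Rd R d)) : measurable U -> multiplier \1_U.
Proof.
have sigma_mult : sigma_algebra setT (fun U : set 'rV[R]_d => multiplier \1_U).
  split.
  - by rewrite indic0; exact: multiplier_cst.
  - move=> A mA; rewrite setTD.
    apply: multiplier_ext (multiplierB (multiplier_cst 1) mA) => x _.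
    by rewrite !indicE in_setC; case: (x \in A); rewrite ?subrr ?subr0.
  - move=> F mF.
    apply: (@multiplier_lim (fun n => \1_(\big[setU/set0]_(i < n) F i)) _ 1).
    + by move=> n x _; rewrite indicE; case: (_ \in _); rewrite ?normr1 ?normr0.
    + move=> x _; rewrite indicE; have [/set_mem[i _ Fx]|/negP Fx] := boolP (x \in _).
        apply: (@cvg_le_harmonic _ _ _ 0 i.+1) => n ni; rewrite mul0r indicE.
        rewrite mem_set ?subrr ?normr0//.
        by rewrite -bigcup_mkord; exists i.
      apply: (@cvg_le_harmonic _ _ _ 0 0) => n _; rewrite mul0r indicE memNset ?subrr ?normr0//.
      by rewrite -bigcup_mkord => -[i _ Fi]; apply: Fx; apply: mem_set; exists i.
    + elim=> [|n ih]; first by rewrite big_ord0 indic0; exact: multiplier_cst.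
      by rewrite big_ord_recr/=; exact: multiplier_setU.
move: U; apply: smallest_sub => // V /open_sigma_halfspaces.
move: V; apply: smallest_sub => // _ [i [s ->]].
(* On [K], [x_i < s] is equivalent to [x_i + s (b.x) < s (1 + b.x)]. *)
apply: multiplier_ext (multiplier_halfspace (delta_mx ord0 i + s *: b) s) => x Kx.
have b0 : 0 < 1 + dotp b x by have := b_ge0 Kx; lra.
rewrite indicE /proj dotpDl dotpZl dotp_delta weightE// ltr_pdivrMr//.
rewrite mulrDr mulr1 ltrD2r; congr (nat_of_bool _)%:R.
by apply/idP/idP => [h|/set_mem//]; exact: mem_set.
Qed.

Theorem fantappie_unique (U : set (Rd R d)) : measurable U -> mu (U `&` K) = nu (U `&` K).
Proof.
move=> mU; rewrite -!integral_indic//; rewrite -/(same \1_U).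
have mult_U := multiplier_indic mU.
have zb x : K x -> 0 <= z b x < 1.
  move=> Kx; rewrite /proj weightE//; have b0 := b_ge0 Kx.
  by rewrite divr_ge0//=; [rewrite ltr_pdivrMr|]; lra.
have indic01 x : 0 <= (\1_U x : R) <= 1.
  by rewrite indicE; case: (_ \in _); rewrite ?lexx ler01.
have multS n : multiplier (fun x => \sum_(i < n) z b x ^+ i).
  elim: n => [|n ih]; first by under eq_fun do rewrite big_ord0; exact: multiplier_cst.
  under eq_fun do rewrite big_ord_recr/=.
  by apply: multiplierD => //; apply: multiplierX; exact: multiplier_projb.
have bmU : bm \1_U by have [] := mult_U.
(* As [weight = 1 - z b], the weight times the partial geometric sum of [z b] is [1 - z b ^ n],
   which tends to [1]. *)
apply: (@same_lim (fun n x => \1_U x * (1 - z b x ^+ n)) _ 1) => //.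
- move=> n; apply: bmM => //; apply: bmD; first exact: bm_cst.
  under eq_fun do rewrite -mulN1r; apply: bmZ; apply: bmX; exact: bm_proj.
- move=> n x Kx; have /andP[i0 i1] := indic01 x; have /andP[z0 z1] := zb x Kx.
  have zn0 : 0 <= z b x ^+ n by rewrite exprn_ge0.
  have zn1 : z b x ^+ n <= 1 by rewrite exprn_ile1// ltW.
  by rewrite ger0_norm ?mulr_ge0 ?subr_ge0// mulr_ile1 ?subr_ge0// gerBl.
- move=> x Kx; rewrite -[X in _ --> X]mulr1; apply: cvgM; first exact: cvg_cst.
  rewrite -[X in _ --> X]subr0; apply: cvgB; first exact: cvg_cst.
  by apply: cvg_expr; have /andP[z0 z1] := zb x Kx; rewrite ger0_norm.
(* The index [0] is chosen because [E 0 = 1]. *)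
move=> n; have [_ /(_ 0)] := (multS n).2 _ (mult_U.2 _ tested1).
apply: same_ext => x Kx; rewrite mul1r.
have -> : E 0 x = 1 by rewrite /E -(scale0r b) projZ mul0r expR0.
rewrite mul1r -mulrA; congr (_ * _).
have w1 : weight x = 1 - z b x.
  rewrite /proj weightE//; have b0 : 1 + dotp b x != 0 by rewrite gt_eqF//; have := b_ge0 Kx; lra.
  by field.
by rewrite w1 mulrC -[RHS]opprB subrX1 -[RHS]mulNr opprB.
Qed.

End Uniqueness.

(** * Gaps between the extremal values *)

Section DualCone.
Context {R : realType} {d : nat}.
Implicit Types (G : set 'rV[R]_d) (a x : 'rV[R]_d).

Lemma dotpC a x : dotp a x = dotp x a.
Proof. by apply: eq_bigr => i _; rewrite mulrC. Qed.

Lemma closed_dual_cone G : closed (dual_cone G).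
Proof.
have -> : dual_cone G = \bigcap_(x in G) [set e | 0 <= dotp x e].
  by apply/seteqP; split => e h x Gx; [rewrite /= dotpC; exact: h|rewrite dotpC; exact: h].
apply: closed_bigI => x _; apply: (@preimage_closed _ _ (dotp x) [set y | 0 <= y]).
  by move=> e _; exact: continuous_dotp.
exact: closed_ge.
Qed.

Lemma interior_dual_bound G a : interior G a ->
  exists2 eps, 0 < eps &
    forall x, dual_cone G x -> eps * \sum_(i < d) `|x ord0 i| <= dotp a x.
Proof.
move=> /nbhs_ballP[e /= e0 eG]; exists (e / 2) => [|x Kx]; first by rewrite divr_gt0.
(* Moving [a] by [e / 2] against the signs of [x] stays in [G] and lowers the pairing with [x] by
   exactly [e / 2] times the sum of the [|x_i|]. *)
pose y : 'rV[R]_d := \row_i (a ord0 i - e / 2 * Num.sg (x ord0 i)).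
have Gy : G y.
  apply: eG; split => // i j; rewrite (ord1 i) /ball/= mxE opprB addrC subrK.
  have e2 : 0 < e / 2 by rewrite divr_gt0.
  rewrite normrM gtr0_norm//; apply: (@le_lt_trans _ _ (e / 2)); last by lra.
  by rewrite ler_piMr ?(ltW e2)// normr_sg; case: (x ord0 j != 0).
have := Kx y Gy; rewrite dotpC => yx; rewrite -subr_ge0.
suff <- : dotp y x = dotp a x - e / 2 * \sum_(i < d) `|x ord0 i| by [].
rewrite /dotp mulr_sumr -sumrB; apply: eq_bigr => i _.
by rewrite mxE normrEsg; ring.
Qed.

End DualCone.

Lemma integrable_integralN d (T : measurableType d) (R : realType)
    (la : {measure set T -> \bar R}) (D : set T) (g : T -> \bar R) :
  measurable D -> la.-integrable D g ->
  (\int[la]_(x in D) - g x = - \int[la]_(x in D) g x)%E.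
Proof.
move=> mD ig; apply: integralN; apply: fin_num_adde_defl.
by rewrite fin_numN integrable_neg_fin_num.
Qed.

(** * The transform of admissible measures and its relation to gaps *)

Section Fantappie.
Context {R : realType} {d : nat}.
Variable G : set 'rV[R]_d.
Local Notation K := (dual_cone G).
Implicit Types (la : {measure set (Rd R d) -> \bar R}) (a b x : 'rV[R]_d).

(* The absolute value is immaterial on [K]; it makes the kernel continuous everywhere. *)
Definition fantappie_kernel a x : R := (`|dotp a x| + 1)^-1.
Local Notation f := fantappie_kernel.

Definition fantappie la a : R := fine (\int[la]_x (f a x)%:E).

Let den_gt0 (y : R) : 0 < `|y| + 1. Proof. by rewrite ltr_wpDl. Qed.

Lemma continuous_kernel a : continuous (f a).
Proof.
apply: continuous_invf => [x|]; first by rewrite gt_eqF.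
apply: continuous_addf; last exact: continuous_cstf.
by apply: continuous_normf; exact: continuous_dotp.
Qed.

Lemma kernel_bound a x : `|f a x| <= 1.
Proof. by rewrite ger0_norm ?invr_ge0 ?(ltW (den_gt0 _))// invf_le1// lerDr. Qed.

Lemma kernelE a x : interior G a -> K x -> f a x = (dotp a x + 1)^-1.
Proof.
move=> /interior_subset Ga Kx; rewrite /f ger0_norm// dotpC; exact: Kx.
Qed.

Lemma admissible_finite la : admissible la K -> (la setT < +oo)%E.
Proof.
move=> [_ _ /(_ 1)]; have -> : (fun x : Rd R d => (polyfun 1 x)%:E) = cst 1%E.
  by apply/funext => x; rewrite /polyfun mpoly.meval1.
move/integrableP => [_]; under eq_integral do rewrite /= normr1.
by rewrite integral_cst// mul1e.
Qed.

Lemma integrable_kernel la a : admissible la K ->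
  la.-integrable setT (fun x : Rd R d => (f a x)%:E).
Proof.
move=> la_adm; apply: measurable_bounded_integrable => //.
- exact: admissible_finite.
- exact: (continuous_measurable_Rd _ (@continuous_kernel a)).
exists 1; split; first exact: num_real.
by move=> M M1 x _; apply: le_trans (kernel_bound _ _) (ltW M1).
Qed.

Lemma fantappieE la a : admissible la K ->
  (\int[la]_x (f a x)%:E = (fantappie la a)%:E)%E.
Proof. by move=> la_adm; rewrite fineK// integrable_fin_num// integrable_kernel. Qed.

Lemma le_integral_dual la (g h : Rd R d -> R) : admissible la K ->
  la.-integrable setT (EFin \o g) -> la.-integrable setT (EFin \o h) ->
  (forall x, K x -> g x <= h x) ->
  (\int[la]_x (g x)%:E <= \int[la]_x (h x)%:E)%E.
Proof.
move=> [_ laK _] ig ih gh.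
have mK := closed_measurable_Rd (@closed_dual_cone _ _ G).
rewrite !(supported_integral (@closed_dual_cone _ _ G))//.
apply: le_integral => //; [exact: (integrableS measurableT)|
  exact: (integrableS measurableT)|].
by move=> x /set_mem Kx; rewrite lee_fin; exact: gh.
Qed.

Lemma fantappie_between mu la a : interior G a -> admissible la K -> moment_equiv mu la ->
  (lower_val mu K a <= (fantappie la a)%:E <= upper_val mu K a)%E.
Proof.
move=> Ga la_adm mla; have [_ _ lap] := la_adm; rewrite -fantappieE//.
apply/andP; split.
  apply: ge_ereal_sup => _ [p pf <-]; rewrite mla.
  apply: (le_integral_dual la_adm (lap p) (integrable_kernel a la_adm)).
  by move=> x Kx; rewrite kernelE//; exact: pf.
apply: le_ereal_inf_tmp => _ [p pf <-]; rewrite mla.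
apply: (le_integral_dual la_adm (integrable_kernel a la_adm) (lap p)).
by move=> x Kx; rewrite kernelE//; exact: pf.
Qed.

(** The kernels differ by [(a.x - b.x) f_a f_b]. The first factor is at most [k (a.x)] on [K], and
    [f_a] absorbs [a.x], so the difference is at most [k] uniformly. *)
Lemma fantappie_lipschitz la a b eps : admissible la K -> 0 < eps ->
  (forall x, K x -> eps * \sum_(i < d) `|x ord0 i| <= dotp a x) ->
  `|fantappie la b - fantappie la a| <= `|b - a| / eps * fine (la setT).
Proof.
move=> la_adm eps0 aK.
have laT := admissible_finite la_adm.
pose k := `|b - a| / eps.
have kb x : K x -> `|f b x - f a x| <= k.
  move=> Kx; have a0 : 0 <= dotp a x.
    by apply: le_trans (aK x Kx); rewrite mulr_ge0 ?(ltW eps0)// sumr_ge0.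
  have dk : `|dotp b x - dotp a x| <= k * dotp a x.
    have -> : dotp b x - dotp a x = dotp (b - a) x.
      by rewrite dotpDl -[- a]scaleN1r dotpZl mulN1r.
    apply: le_trans (dotp_norm_le _ _) _; rewrite /k -mulrA ler_wpM2l//.
    by rewrite ler_pdivlMl//; exact: aK.
  have -> : f b x - f a x = (`|dotp a x| - `|dotp b x|) * (f a x * f b x).
    by rewrite /f; field; rewrite !gt_eqF.
  rewrite normrM distrC; apply: (@le_trans _ _ (k * dotp a x * (f a x * 1))).
    apply: ler_pM => //.
      by apply: le_trans dk; exact: ler_dist_dist.
    by rewrite normrM ler_pM ?kernel_bound// /f ger0_norm// invr_ge0 ltW.
  rewrite mulr1 /f (ger0_norm a0) ler_pdivrMr; last by lra.
  have k0 : 0 <= k by rewrite divr_ge0// ltW.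
  by rewrite ler_wpM2l//; lra.
have icst : la.-integrable setT (EFin \o cst k).
  apply: measurable_bounded_integrable => //; exists k; split; first exact: num_real.
  move=> M kM x _ /=; rewrite ger0_norm ?(ltW kM)//; by rewrite divr_ge0// ltW.
have Icst : (\int[la]_x (k%:E) = (k * fine (la setT))%:E)%E.
  by rewrite integral_cst// [RHS]EFinM fineK// ge0_fin_numE.
have one u v : (forall x, K x -> f u x <= f v x + k) ->
    fantappie la u <= fantappie la v + k * fine (la setT).
  move=> uv; rewrite -lee_fin EFinD -Icst -!fantappieE//.
  rewrite -integralD//; last exact: integrable_kernel.
  have isum := integrableD measurableT (integrable_kernel v la_adm) icst.
  exact: (@le_integral_dual _ (f u) (fun x => f v x + k) la_adm
    (integrable_kernel u la_adm) isum uv).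
have h1 : fantappie la b <= fantappie la a + k * fine (la setT).
  by apply: one => x /kb; rewrite ler_norml; lra.
have h2 : fantappie la a <= fantappie la b + k * fine (la setT).
  by apply: one => x /kb; rewrite ler_norml; lra.
rewrite -/k ler_norml; move: (k * fine (la setT)) h1 h2 => m h1 h2.
move: (fantappie la b) (fantappie la a) h1 h2 => u v h1 h2.
by apply/andP; split; lra.
Qed.

Lemma fantappie_gap mu a : interior G a -> admissible mu K ->
  (lower_val mu K a < upper_val mu K a)%E ->
  exists nu, [/\ admissible nu K, moment_equiv mu nu & fantappie nu a != fantappie mu a].
Proof.
move=> Ga mu_adm lu.
have Vf : polybounded K (f a).
  by apply: le_polybounded (polybounded_cst 1) => x _; rewrite normr1 kernel_bound.
have [nu [nu_adm nu_eq _ nuI]] :=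
  moment_extension (@closed_dual_cone _ _ G) mu_adm (@continuous_kernel a) Vf.
(* Extending at the opposite kernel attains the lower value: negating polynomials turns this infimum
   into minus a supremum. *)
have [nu' [nu'_adm nu'_eq _ nu'I]] :=
  moment_extension (@closed_dual_cone _ _ G) mu_adm
    (continuous_oppf (@continuous_kernel a)) (polyboundedN Vf).
have nuU : (fantappie nu a)%:E = upper_val mu K a.
  rewrite -fantappieE// nuI; congr ereal_inf; apply/seteqP.
  by split => _ [q qf <-]; exists q => // x Kx; move: (qf x Kx); rewrite kernelE.
have intN p : (\int[mu]_x (polyfun (- p) x)%:E = - \int[mu]_x (polyfun p x)%:E)%E.
  under eq_integral do rewrite polyfunN EFinN.
  by rewrite integrable_integralN//; have [_ _] := mu_adm; apply.
have nu'L : (fantappie nu' a)%:E = lower_val mu K a.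
  move: nu'I; under eq_integral do rewrite EFinN.
  rewrite integrable_integralN//; last exact: integrable_kernel.
  rewrite fantappieE// => /(congr1 oppe); rewrite oppeK => ->.
  rewrite /ereal_inf oppeK; congr ereal_sup; apply/seteqP.
  split => [_ [_ [q qf <-] <-]|_ [q qf <-]].
    exists (- q); last by rewrite intN.
    by move=> x Kx; rewrite polyfunN -kernelE// lerNl; exact: qf.
  exists (- \int[mu]_x (polyfun q x)%:E)%E; last by rewrite oppeK.
  exists (- q); last by rewrite intN.
  by move=> x Kx; rewrite polyfunN lerN2 kernelE//; exact: qf.
(* The two measures give different values at [a], so at least one of them differs from [mu]
   there. *)
have [e1|ne1] := eqVneq (fantappie nu a) (fantappie mu a); last by exists nu.
exists nu'; split => //; apply/eqP => e2.
by move: lu; rewrite -nuU -nu'L e1 e2 ltxx.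
Qed.

(** Both transforms lie between the extremal values; without a gap these coincide and pin both to
    one number. *)
Lemma gap_of_fantappie_neq mu nu a : interior G a -> admissible mu K ->
  admissible nu K -> moment_equiv mu nu -> fantappie nu a != fantappie mu a ->
  (lower_val mu K a < upper_val mu K a)%E.
Proof.
move=> Ga mu_adm nu_adm mn; apply: contra_neqT; rewrite -leNgt => ul.
have /andP[l1 u1] := fantappie_between Ga mu_adm (fun p => erefl).
have /andP[l2 u2] := fantappie_between Ga nu_adm mn.
apply/eqP; rewrite eq_le -!lee_fin.
by rewrite (le_trans u2 (le_trans ul l1)) (le_trans u1 (le_trans ul l2)).
Qed.

(** Without a gap in [B] the transforms agree on a ball around [b], and uniqueness identifies the
    measures. An arbitrary [B] serves both existence, with [B] the interior of [G], and density. *)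
Lemma fantappie_eq_gap mu nu (B : set 'rV[R]_d) : admissible mu K -> admissible nu K ->
  moment_equiv mu nu -> (exists A : set (Rd R d), measurable A /\ nu A <> mu A) ->
  open B -> B `<=` interior G -> B !=set0 ->
  exists2 a, B a & (lower_val mu K a < upper_val mu K a)%E.
Proof.
move=> mu_adm nu_adm mn [A [mA nA]] oB BG [b Bb].
apply: contrapT => nogap; apply: nA.
have Feq a : B a -> fantappie mu a = fantappie nu a.
  move=> Ba; apply: contrapT => /nesym/eqP ne; apply: nogap; exists a => //.
  exact: gap_of_fantappie_neq (BG a Ba) mu_adm nu_adm mn ne.
have [eps eps0 bK] := interior_dual_bound (BG b Bb).
have /nbhs_ballP[r /= r0 rB] := open_nbhs_nbhs (conj oB Bb).
have Kcl := @closed_dual_cone _ _ G.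
have mK := closed_measurable_Rd Kcl.
have finK la : admissible la K -> (la K < +oo)%E.
  move=> la_adm; apply: le_lt_trans (admissible_finite la_adm).
  by apply: le_measure; rewrite ?inE.
have sameF c : `|c| < r ->
    same_integral K mu nu (fun x => (dotp (b + c) x + 1)^-1).
  move=> cr; have Bbc : B (b + c).
    by apply: rB; rewrite mx_norm_ball /ball_/= opprD addrA subrr sub0r normrN.
  have FK la : admissible la K ->
      (\int[la]_(x in K) ((dotp (b + c) x + 1)^-1)%:E = (fantappie la (b + c))%:E)%E.
    move=> la_adm; rewrite -fantappieE// (supported_integral Kcl).
    - by apply: eq_integral => x /set_mem Kx; rewrite kernelE//; exact: BG.
    - by have [_] := la_adm.
    - exact: integrable_kernel.
  by rewrite /same_integral !FK// Feq.
(* Both measures vanish off [K], whereas uniqueness compares traces on [K]. *)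
have AK (la : {measure set (Rd R d) -> \bar R}) : admissible la K -> la A = la (A `&` K).
  move=> [_ laK _]; rewrite -[in LHS](setIT A) -(setUv K) setIUr measureU//.
  - rewrite [X in (_ + X)%E](_ : _ = 0%E) ?adde0//; apply: subset_measure0 laK => //.
    + by apply: measurableI => //; exact: measurableC.
    + exact: measurableC.
  - exact: measurableI.
  - by apply: measurableI => //; exact: measurableC.
  - by rewrite setIACA setICr setI0.
by rewrite !AK// -(@fantappie_unique _ _ K mu nu Kcl (finK _ mu_adm) (finK _ nu_adm) b eps r).
Qed.

End Fantappie.

(** * Existence, openness and density of gaps *)

Theorem theorem2p3 (R : realType) (d : nat) (G : set 'rV[R]_d)
  (mu : {measure set (Rd R d) -> \bar R}) :
  convex_subset G -> is_cone G -> acute G -> solid G ->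
  admissible mu (dual_cone G) ->
  ((exists nu : {measure set (Rd R d) -> \bar R},
      [/\ admissible nu (dual_cone G),
          (exists A : set (Rd R d), measurable A /\ nu A <> mu A) &
          moment_equiv mu nu])
    <->
   (exists a, interior G a /\
      (lower_val mu (dual_cone G) a < upper_val mu (dual_cone G) a)%E))
  /\
  ((exists a, interior G a /\
      (lower_val mu (dual_cone G) a < upper_val mu (dual_cone G) a)%E) ->
   open [set a | interior G a /\
      (lower_val mu (dual_cone G) a < upper_val mu (dual_cone G) a)%E] /\
   interior G `<=` closure [set a | interior G a /\
      (lower_val mu (dual_cone G) a < upper_val mu (dual_cone G) a)%E]).
Proof.
move=> _ _ _ [g0 Gg0] mu_adm.
have differ (nu : {measure set (Rd R d) -> \bar R}) a : fantappie nu a != fantappie mu a ->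
    exists A : set (Rd R d), measurable A /\ nu A <> mu A.
  apply: contra_neqP => same_nu; rewrite /fantappie; congr fine.
  apply: eq_measure_integral => A mA _.
  by apply: contrapT => nA; apply: same_nu; exists A.
split.
  split=> [[nu [nu_adm nuA mn]]|[a [Ga lu]]].
    have [a Ga lu] := fantappie_eq_gap mu_adm nu_adm mn nuA
      (@open_interior _ G) (@subset_refl _ _) (ex_intro _ g0 Gg0).
    by exists a.
  have [nu [nu_adm mn ne]] := fantappie_gap Ga mu_adm lu.
  by exists nu; split => //; exact: differ ne.
move=> [a [Ga lu]]; split.
  rewrite openE => b [Gb lub]; have [nu [nu_adm mn ne]] := fantappie_gap Gb mu_adm lub.
  have [eps eps0 bK] := interior_dual_bound Gb.
  set D := `|fantappie nu b - fantappie mu b|.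
  have D0 : 0 < D by rewrite normr_gt0 subr_eq0.
  pose m := fine (nu setT) + fine (mu setT).
  have m0 : 0 <= m by rewrite addr_ge0// fine_ge0.
  (* Within this radius the two transforms together vary by less than their distance [D] at [b], so
     they stay distinct. The [+ 1] covers the case of zero total mass. *)
  have r0 : 0 < eps * D / (m + 1) by rewrite divr_gt0 ?mulr_gt0// ltr_wpDl.
  have nG : nbhs b (interior G) by apply: open_nbhs_nbhs; split => //; exact: open_interior.
  apply: filterS2 nG (nbhsx_ballx b _ r0) => c Gc; rewrite mx_norm_ball /ball_/= distrC => cb.
  split => //; apply: (gap_of_fantappie_neq Gc mu_adm nu_adm mn).
  have Fn := fantappie_lipschitz c nu_adm eps0 bK.
  have Fm := fantappie_lipschitz c mu_adm eps0 bK.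
  apply/eqP => e.
  have : D <= `|c - b| / eps * m.
    rewrite /m mulrDr; apply: le_trans (lerD Fn Fm).
    rewrite e [X in _ <= X + _]distrC; apply: le_trans (ler_normD _ _).
    by rewrite addrA subrK.
  apply/negP; rewrite -ltNge; move: cb; rewrite ltr_pdivlMr ?ltr_wpDl// => cb.
  rewrite mulrAC ltr_pdivrMr// [D * eps]mulrC; apply: le_lt_trans cb.
  by rewrite ler_wpM2l// lerDl.
(* The measure obtained from the single gap at [a] forces a gap in every nonempty open part of the
   interior. *)
move=> x Gx N Nx; have [nu [nu_adm mn ne]] := fantappie_gap Ga mu_adm lu.
have [||c [Nc Gc] luc] := fantappie_eq_gap (B := interior N `&` interior G)
    mu_adm nu_adm mn (differ _ _ ne) _ (@subIsetr _ _ _).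
- by apply: openI; exact: open_interior.
- by exists x; split => //; exact: nbhs_interior.
- by exists c; split => //; exact: interior_subset Nc.
Qed.
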